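(* Let $F:\mathcal{S}_n\to\mathbb{R}$ be uniformly elliptic, continuous and quasiconcave, and let $u,v\in C(B_1)$ be viscosity subsolutions of $F(D^2w)=0$ in $B_1\subset\mathbb{R}^n$. Then for every $\theta\in(0,1)$ the function $w=\theta u+(1-\theta)v$ is a viscosity subsolution of $F(D^2w)=0$ in $B_1$.
   Context: $\mathcal{S}_n$ is the space of real symmetric $n\times n$ matrices. $F$ is uniformly elliptic with constants $0<\lambda\le\Lambda$ if $\lambda\|N\|\leq F(M+N)-F(M)\leq\Lambda\|N\|$ for all $M,N\in\mathcal{S}_n$ with $N\geq0$, where $\|N\|=\sup_{|x|=1}|Nx|$. $F$ is quasiconcave if $F(\theta M_1+(1-\theta)M_2)\geq\min\{F(M_1),F(M_2)\}$ for all $M_1,M_2\in\mathcal{S}_n$, $\theta\in[0,1]$. A continuous $u$ is a viscosity subsolution of $F(D^2u)=0$ in $\Omega$ if whenever $\varphi\in C^2(\Omega)$ and $u-\varphi$ has a local maximum at $x_0\in\Omega$, then $F(D^2\varphi(x_0))\geq0$. *)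

(* Defs.v *)
From HB Require Import structures.
From mathcomp Require Import all_boot all_order all_algebra.
From mathcomp Require Import all_classical all_reals all_analysis.
Set Implicit Arguments. Unset Strict Implicit. Unset Printing Implicit Defensive.
Import Order.TTheory GRing.Theory Num.Theory.
Import numFieldNormedType.Exports.
Local Open Scope classical_set_scope.
Local Open Scope ring_scope.

Section Defs.
Variables (R : realType) (n : nat).

Definition enorm (x : 'rV[R]_n) : R := Num.sqrt (\sum_(i < n) x ord0 i ^+ 2).

Definition opnorm (N : 'M[R]_n) : R :=
  sup [set enorm (x *m N^T) | x in [set x : 'rV[R]_n | enorm x = 1]].

Definition symmx (M : 'M[R]_n) : Prop := M^T = M.

Definition psd (N : 'M[R]_n) : Prop := forall x : 'rV[R]_n, 0 <= (x *m N *m x^T) ord0 ord0.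

Definition unif_elliptic (F : 'M[R]_n -> R) (lam Lam : R) : Prop :=
  0 < lam /\ lam <= Lam /\
  forall M N : 'M[R]_n, symmx M -> symmx N -> psd N ->
    lam * opnorm N <= F (M + N) - F M /\ F (M + N) - F M <= Lam * opnorm N.

Definition quasiconcave (F : 'M[R]_n -> R) : Prop :=
  forall (M1 M2 : 'M[R]_n) (t : R), symmx M1 -> symmx M2 -> 0 <= t <= 1 ->
    Num.min (F M1) (F M2) <= F (t *: M1 + (1 - t) *: M2).

Definition B1 : set 'rV[R]_n := [set x | enorm x < 1].

Definition evec (i : 'I_n) : 'rV[R]_n := delta_mx ord0 i.
Definition partial (i : 'I_n) (f : 'rV[R]_n -> R) : 'rV[R]_n -> R :=
  fun x => derive f x (evec i).

Definition C2_on (Omega : set 'rV[R]_n) (f : 'rV[R]_n -> R) : Prop :=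
  forall x, Omega x ->
    {for x, continuous f} /\
    forall i : 'I_n, derivable f x (evec i) /\ {for x, continuous (partial i f)} /\
      forall j : 'I_n, derivable (partial i f) x (evec j) /\
        {for x, continuous (partial j (partial i f))}.

Definition hessian (f : 'rV[R]_n -> R) (x : 'rV[R]_n) : 'M[R]_n :=
  \matrix_(i, j) partial j (partial i f) x.

Definition visc_subsol (F : 'M[R]_n -> R) (Omega : set 'rV[R]_n)
    (u : 'rV[R]_n -> R) : Prop :=
  {within Omega, continuous u} /\
  forall (phi : 'rV[R]_n -> R) (x0 : 'rV[R]_n),
    C2_on Omega phi -> Omega x0 ->
    (\forall x \near x0, u x - phi x <= u x0 - phi x0) ->
    0 <= F (hessian phi x0).

End Defs.

(* Main.v *)
Require Import Defs.
From HB Require Import structures.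
From mathcomp Require Import all_boot all_order all_algebra.
From mathcomp Require Import all_classical all_reals all_analysis.
From mathcomp Require Import ring lra.
Set Implicit Arguments. Unset Strict Implicit. Unset Printing Implicit Defensive.
Import Order.TTheory GRing.Theory Num.Theory.
Import numFieldNormedType.Exports.
Local Open Scope classical_set_scope.
Local Open Scope ring_scope.

(* Ellipticity, continuity and quasiconcavity make [0 <= F] define a closed
   convex set of symmetric matrices which is stable under the addition of
   positive semidefinite matrices. If it misses [hessian phi z], a hyperplane
   separates them: there are a nonzero positive semidefinite [A] and a [c] with
   [\tr (A *m hessian phi z) < c], while [c <= \tr (A *m M)] whenever
   [0 <= F M]. Thus [u] and [v] are viscosity subsolutions of the linear
   equation [\tr (A *m hessian w x) = c], and it suffices to treat that one.

   A continuous [w] is a viscosity subsolution of the linear equation if and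
   only if, for all [k < c] and on every ball, it lies below C2 solutions of
   [\tr (A *m hessian h x) = k] that are arbitrarily close to it on the sphere.
   Since the latter equation is linear, this property passes to convex
   combinations. The majorants exist by comparison: approximate [w] uniformly
   by a polynomial, and solve the Dirichlet problem for polynomial data. Its
   solution is a polynomial, because [p |-> \tr (A *m hessian (b * p))], with
   [b x = r ^+ 2 - |x - z| ^+ 2], is injective, hence onto, on the polynomials
   of degree at most [d]. *)

(** * Positive semidefinite matrices *)

Section PositiveSemidefiniteMatrices.
Context {R : realType} {n : nat}.
Implicit Types (A H N : 'M[R]_n) (x y e : 'rV[R]_n).

Definition bform A x y : R := (x *m A *m y^T) ord0 ord0.

Lemma bform_delta_mx A i j :
  bform A (delta_mx ord0 i) (delta_mx ord0 j) = A i j.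
Proof. by rewrite /bform -rowE trmx_delta -colE !mxE. Qed.

Lemma bformNl A x y : bform (- A) x y = - bform A x y.
Proof. by rewrite /bform mulmxN mulNmx mxE. Qed.

Lemma bformB A x e (s : R) : bform A (x - s *: e) (x - s *: e) =
  bform A x x - s * bform A x e - s * bform A e x + s ^+ 2 * bform A e e.
Proof.
rewrite /bform [(x - _)^T]raddfB/= !(mulmxBl, mulmxBr) [(s *: e)^T]linearZ/=.
rewrite -!scalemxAl -!scalemxAr.
move: (x *m A *m x^T) (x *m A *m e^T) (e *m A *m x^T) (e *m A *m e^T).
by move=> a b c d; rewrite !mxE; ring.
Qed.

Lemma bformC A x y : symmx A -> bform A x y = bform A y x.
Proof.
have trE (M : 'M[R]_1) : M ord0 ord0 = M^T ord0 ord0 by rewrite mxE.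
by move=> As; rewrite /bform [LHS]trE !trmx_mul trmxK As mulmxA.
Qed.

Lemma symmx_gram m (B : 'M[R]_(m, n)) : symmx (B^T *m B).
Proof. by rewrite /symmx trmx_mul trmxK. Qed.

Lemma psd_gram m (B : 'M[R]_(m, n)) : psd (B^T *m B).
Proof.
move=> x; have -> : x *m (B^T *m B) *m x^T = (B *m x^T)^T *m (B *m x^T).
  by rewrite trmx_mul trmxK !mulmxA.
by rewrite mxE sumr_ge0// => k _; rewrite mxE -expr2 sqr_ge0.
Qed.

Lemma psd_diag_ge0 A i : psd A -> 0 <= A i i.
Proof. by rewrite -(bform_delta_mx A i i); apply. Qed.

Lemma psd_diag_eq0 A i j : symmx A -> psd A -> A i i = 0 -> A i j = 0.
Proof.
move=> As Ap Aii; apply/eqP; apply: contraT => Aij.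
have Aji : A j i = A i j by rewrite -{1}As mxE.
pose s := (A j j + 1) / (2 * A i j).
have := Ap (delta_mx ord0 j - s *: delta_mx ord0 i).
rewrite -/(bform _ _ _) bformB !bform_delta_mx Aii Aji mulr0 addr0.
have -> : A j j - s * A i j - s * A i j = -1 by rewrite /s; field.
by rewrite lerNr oppr0 ler10.
Qed.

Lemma psd_mxtrace_gt0 A : symmx A -> psd A -> A != 0 -> 0 < \tr A.
Proof.
move=> As Ap; apply: contraNT; rewrite -leNgt => trA_le0.
have diag_eq0 i : A i i = 0.
  have : \sum_k A k k == 0.
    by rewrite eq_le trA_le0 sumr_ge0// => k _; exact: psd_diag_ge0.
  rewrite psumr_eq0 => [/allP/(_ i)|k _]; last exact: psd_diag_ge0.
  by rewrite mem_index_enum => /(_ isT)/eqP.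
by apply/eqP/matrixP => i j; rewrite mxE psd_diag_eq0.
Qed.

Definition schur_step A k : 'M[R]_n :=
  A - (A k k)^-1 *: ((row k A)^T *m row k A).

Lemma schur_stepE A k i j :
  schur_step A k i j = A i j - (A k k)^-1 * (A k i * A k j).
Proof. by rewrite !mxE big_ord1 !mxE. Qed.

Lemma schur_step_symmx A k : symmx A -> symmx (schur_step A k).
Proof.
by move=> As; rewrite /symmx [LHS]raddfB/= linearZ/= As symmx_gram.
Qed.

Lemma schur_step_psd A k : symmx A -> psd A -> A k k != 0 ->
  psd (schur_step A k).
Proof.
move=> As Ap Akk x; pose e : 'rV[R]_n := delta_mx ord0 k.
pose s := bform A e x / A k k.
have exE : bform A e x = s * A k k by rewrite /s divfK.
have := Ap (x - s *: e).
rewrite -/(bform _ _ _) bformB (bformC x e As) exE bform_delta_mx.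
congr (0 <= _).
have -> : x *m schur_step A k *m x^T =
    x *m A *m x^T - (A k k)^-1 *: ((row k A *m x^T)^T *m (row k A *m x^T)).
  rewrite /schur_step mulmxBr mulmxBl -scalemxAr -scalemxAl.
  by congr (_ - _ *: _); rewrite trmx_mul trmxK !mulmxA.
move: exE; rewrite /bform -rowE.
move: (x *m A *m x^T) (row k A *m x^T) => M N NE.
by rewrite !mxE big_ord1 !mxE NE; field.
Qed.

(* Cholesky elimination: each Schur step clears one more row. *)
Lemma psd_sum_rank1 A : symmx A -> psd A ->
  exists s : seq 'rV[R]_n, A = \sum_(x <- s) x^T *m x.
Proof.
suff clear_rows m B : symmx B -> psd B ->
    (forall i j : 'I_n, (m <= i)%N -> B i j = 0) ->
    exists s : seq 'rV[R]_n, B = \sum_(x <- s) x^T *m x.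
  by move=> As Ap; apply: (clear_rows n) => // i j; rewrite leqNgt ltn_ord.
elim: m B => [|m IHm] B Bs Bp B0.
  by exists [::]; rewrite big_nil; apply/matrixP => i j; rewrite B0// mxE.
have [mn|nm] := ltnP m n; last first.
  by apply: IHm => // i j mi; have := leq_trans nm mi; rewrite leqNgt ltn_ord.
pose k := Ordinal mn.
have row_m (i : 'I_n) : m = i -> i = k by move=> mi; exact/val_inj.
have [Bkk|Bkk] := eqVneq (B k k) 0.
  apply: IHm => // i j; rewrite leq_eqVlt => /orP[/eqP/row_m ->|].
    exact: psd_diag_eq0.
  exact: B0.
have [|||s sE] := IHm (schur_step B k).
- exact: schur_step_symmx.
- exact: schur_step_psd.
- move=> i j; rewrite leq_eqVlt schur_stepE => /orP[/eqP/row_m ->|mi].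
    by rewrite mulrA mulVf// mul1r subrr.
  have Bki : B k i = B i k by rewrite -{1}Bs mxE.
  by rewrite B0// Bki (B0 i k mi) mul0r mulr0 subr0.
have Bkk0 : 0 <= (B k k)^-1 by rewrite invr_ge0 psd_diag_ge0.
exists (Num.sqrt (B k k)^-1 *: row k B :: s); rewrite big_cons -sE.
rewrite [(_ *: _)^T]linearZ/= -scalemxAl -scalemxAr scalerA -expr2 sqr_sqrtr//.
by rewrite addrC subrK.
Qed.

Lemma psd_mxtrace_mul_ge0 A H : symmx A -> psd A -> psd H -> 0 <= \tr (A *m H).
Proof.
move=> As Ap Hp; have [s ->] := psd_sum_rank1 As Ap.
rewrite mulmx_suml raddf_sum/= sumr_ge0// => x _.
by rewrite -mulmxA mxtrace_mulC trace_mx11.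
Qed.

End PositiveSemidefiniteMatrices.

(** * Second derivative test and symmetry of the Hessian *)

Lemma near_open (T : topologicalType) (U : set T) (x : T) : open U -> U x ->
  \forall y \near x, U y.
Proof. by move=> U_open Ux; exact: open_nbhs_nbhs. Qed.

Section DerivativesAlongLines.
Context {R : realType} {V : normedModType R}.
Implicit Types (f : V -> R) (x v c : V) (t : R).

Lemma cvg_line x v : x + t *: v @[t --> (0 : R)] --> x.
Proof.
rewrite -[in X in _ --> X](addr0 x) -(scale0r v).
by apply: cvgD; [exact: cvg_cst|apply: cvgZ; [exact: cvg_id|exact: cvg_cst]].
Qed.

Lemma cvg_is_derive f x v (l : R) :
  h^-1 *: ((f \o shift x) (h *: v) - f x) @[h --> 0^'] --> l ->
  is_derive x v f l.
Proof.
by move=> quot_cvg; split; [apply/cvg_ex; exists l|exact: cvg_lim quot_cvg].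
Qed.

Lemma is_derive_translate f c x v : derivable f (x + c) v ->
  is_derive x v (fun y => f (y + c)) ('D_v f (x + c)).
Proof.
move=> fd; have quotE : (fun h : R => h^-1 *:
      (((fun y => f (y + c)) \o shift x) (h *: v) - f (x + c))) =
    (fun h : R => h^-1 *: ((f \o shift (x + c)) (h *: v) - f (x + c))).
  by apply/funext => h /=; rewrite addrA.
by split; rewrite /derivable /derive quotE.
Qed.

Lemma is_derive_line f x v t : derivable f (x + t *: v) v ->
  is_derive t 1 (fun s => f (x + s *: v)) ('D_v f (x + t *: v)).
Proof.
move=> fd; have quotE : (fun h : R => h^-1 *:
      (((fun s => f (x + s *: v)) \o shift t) (h *: 1) - f (x + t *: v))) =
    (fun h : R => h^-1 *:
      ((f \o shift (x + t *: v)) (h *: v) - f (x + t *: v))).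
  apply/funext => h /=; congr (_ *: (f _ - _)).
  by rewrite scalerDl [h *: 1]mulr1 addrCA.
by split; rewrite /derivable /derive quotE.
Qed.

Lemma MVT_line f x v t :
  (forall s : R, `|s| <= `|t| -> derivable f (x + s *: v) v) ->
  exists2 s, `|s| <= `|t| & f (x + t *: v) - f x = t * 'D_v f (x + s *: v).
Proof.
move=> fd; pose g r := f (x + (t * r) *: v).
have small (r : R) : r \in `[0, 1] -> `|t * r| <= `|t|.
  by rewrite in_itv/= => /andP[r0 r1]; rewrite normrM (ger0_norm r0) ler_piMr.
have gd (r : R) : r \in `[0, 1] ->
    is_derive r 1 g ('D_v f (x + (t * r) *: v) * t).
  move=> /small/fd/is_derive_line fd'.
  apply: (is_derive1_comp (f := fun s => f (x + s *: v)) (g := t \*: id)) => //.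
  by apply: is_derive_eq; rewrite [t *: 1]mulr1.
have gc : {within `[0, 1], continuous g}.
  by apply: derivable_within_continuous => r /gd[].
have [r r01] :=
  MVT_segment ler01 (fun r r01 => gd r (subset_itv_oo_cc r01)) gc.
rewrite /g mulr0 scale0r addr0 mulr1 subr0 mulr1 mulrC => incrE.
by exists (t * r); first exact: small.
Qed.

End DerivativesAlongLines.

Section SecondDerivativeOnTheLine.
Context {R : realType}.
Implicit Types (g dg : R -> R) (t q : R).

Lemma is_derive_gt0_near_right g t q : is_derive t 1 g q -> 0 < q ->
  \forall s \near t^'+, g t < g s.
Proof.
move=> [gd gE] q0; rewrite near_withinE.
have : \forall h \near 0^', 0 < h^-1 *: ((g \o shift t) (h *: 1) - g t).
  have : (h^-1 *: ((g \o shift t) (h *: 1) - g t) @[h --> 0^']) --> q.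
    by rewrite -gE.
  by move/cvgr_gt; apply.
rewrite near_withinE => /nbhs_ballP[e /= e0 quot_gt0].
apply/nbhs_ballP; exists e => // s /= ste ts.
have := quot_gt0 (s - t); rewrite /ball/= sub0r normrN distrC => /(_ ste).
rewrite subr_eq0 gt_eqF// [(s - t) *: 1]mulr1 subrK => /(_ isT).
by rewrite pmulr_rgt0 ?invr_gt0 subr_gt0.
Qed.

Lemma local_max_second_derivative_le0 g dg t q :
  (\forall s \near t, is_derive (s : R) 1 g (dg s)) -> is_derive t 1 dg q ->
  (\forall s \near t, g s <= g t) -> q <= 0.
Proof.
move=> gd dgd gmax; rewrite leNgt; apply/negP => q0.
have [d /= d0 gP] : exists2 d, 0 < d &
    forall s, `|t - s| < d -> is_derive s 1 g (dg s) /\ g s <= g t.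
  by apply/nbhs_ballP; near=> s; split; near: s.
have dg_t : dg t = 0.
  have t_itv (s : R) : s \in `]t - d, t + d[ -> `|t - s| < d.
    by rewrite in_itv/= distrC => ?; rewrite ltr_distl.
  have [||||_ <-] := @derive1_at_max R g (t - d) (t + d) t.
  - by lra.
  - by move=> s /t_itv/gP[[]].
  - by rewrite in_itv/=; lra.
  - by move=> s /t_itv/gP[].
  by have [|[_ ->]] := gP t; first by rewrite subrr normr0.
have := is_derive_gt0_near_right dgd q0.
rewrite near_withinE dg_t => /nbhs_ballP[e /= e0 dg_gt0].
pose s := t + Num.min d e / 2.
have [ts sd se] : [/\ t < s, s - t < d & s - t < e].
  by rewrite /s; split; have [de|ed] := leP d e; lra.
have near_t r : r \in `[t, s] -> `|t - r| < d /\ `|t - r| < e.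
  by rewrite in_itv/= => ?; split; rewrite distrC ger0_norm; lra.
have gc : {within `[t, s], continuous g}.
  by apply: derivable_within_continuous => r /near_t[/gP[[]]].
have [r rts incrE] :=
  MVT ts (fun r rts => (gP r (near_t r (subset_itv_oo_cc rts)).1).1) gc.
have dgr : 0 < dg r.
  have [_ re] := near_t r (subset_itv_oo_cc rts).
  by apply: dg_gt0 re _; rewrite (itvP rts).
have : g s <= g t.
  by have [|/gP[]] := near_t s; first by rewrite in_itv/= (ltW ts) lexx.
by rewrite -subr_le0 incrE leNgt mulr_gt0 ?subr_gt0.
Unshelve. all: end_near. Qed.

End SecondDerivativeOnTheLine.

Section PartialDerivatives.
Context {R : realType} {n : nat}.
Implicit Types (f : 'rV[R]_n -> R) (x y z a : 'rV[R]_n).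

Lemma mx_norm_leP z (c : R) : 0 <= c ->
  `|z| <= c <-> forall j, `|z ord0 j| <= c.
Proof.
move=> c0; rewrite [`|z|]mx_normrE; split=> [/bigmax_leP[_ h] j|h].
  exact: (h (ord0, j)).
by apply/bigmax_leP; split => // -[i j] _ /=; rewrite ord1.
Qed.

Lemma coord_le_norm z j : `|z ord0 j| <= `|z|.
Proof. by move: j; apply/mx_norm_leP. Qed.

(* Telescopes along the path from [x] to [x + z] which changes one coordinate
   at a time. *)
Lemma increment_partials f x z :
  (forall y, `|y - x| <= `|z| -> forall i, derivable f y (evec R i)) ->
  exists2 w : 'I_n -> 'rV[R]_n, (forall i, `|w i| <= `|z|) &
    f (x + z) - f x = \sum_i z ord0 i * partial i f (x + w i).
Proof.
move=> fd.
pose head k : 'rV[R]_n := \row_j (if (j < k)%N then z ord0 j else 0).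
have headS (i : 'I_n) : head i.+1 = head i + z ord0 i *: evec R i.
  apply/rowP => j; rewrite !mxE eqxx/= ltnS [j == i]/eq_op/=.
  case: (ltngtP j i) => [||/val_inj ->]; rewrite ?mulr0 ?addr0//.
  by rewrite mulr1 add0r.
have head_small (i : 'I_n) (s : R) : `|s| <= `|z ord0 i| ->
    `|head i + s *: evec R i| <= `|z|.
  move=> sz; apply/mx_norm_leP => // j; rewrite !mxE eqxx/=.
  have [->|ji] := eqVneq j i; rewrite ?ltnn ?mulr1 ?mulr0 ?add0r ?addr0.
    by rewrite (le_trans sz)// coord_le_norm.
  by case: ifP => _; rewrite ?normr0// coord_le_norm.
have /choice[w wP] (i : 'I_n) : exists w, `|w| <= `|z| /\
    f (x + head i.+1) - f (x + head i) = z ord0 i * partial i f (x + w).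
  have [|s sz incrE] := @MVT_line R _ f (x + head i) (evec R i) (z ord0 i).
    move=> s /head_small zs; apply: fd.
    by rewrite -[x + _ + _]addrA [x + _]addrC addrK.
  exists (head i + s *: evec R i); split; first exact: head_small.
  by rewrite headS !addrA.
exists w => [i|]; first by have [] := wP i.
have -> : z = head n by apply/rowP => j; rewrite mxE ltn_ord.
have {2}-> : x = x + head 0%N.
  by rewrite -[LHS]addr0; congr (_ + _); apply/rowP => j; rewrite !mxE.
rewrite -(@telescope_sumr _ 0 n (fun k => f (x + head k)))// big_mkord.
by apply: eq_bigr => i _; rewrite (wP i).2 mxE ltn_ord.
Qed.

Lemma near_increment_partials f x :
  (\forall y \near x, forall i, derivable f y (evec R i)) ->
  exists w : 'rV[R]_n -> 'I_n -> 'rV[R]_n, \forall z \near (0 : 'rV[R]_n),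
    (forall i, `|w z i| <= `|z|) /\
    f (x + z) - f x = \sum_i z ord0 i * partial i f (x + w z i).
Proof.
move=> /nbhs_normP[d /= d0 fd].
have /choice[w wP] (z : 'rV[R]_n) : exists w : 'I_n -> 'rV[R]_n, `|z| < d ->
    (forall i, `|w i| <= `|z|) /\
    f (x + z) - f x = \sum_i z ord0 i * partial i f (x + w i).
  have [dz|zd] := leP d `|z|; first by exists (fun=> 0).
  have [y yz|w ? ?] := @increment_partials f x z; last by exists w.
  by apply: fd; rewrite /ball_/= distrC; exact: le_lt_trans zd.
exists w; apply/nbhs_normP; exists d => // z; rewrite /ball_/= sub0r normrN.
exact: wP.
Qed.

Lemma is_derive_partials f x a :
  (\forall y \near x, forall i, derivable f y (evec R i)) ->
  (forall i, {for x, continuous (partial i f)}) ->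
  is_derive x a f (\sum_i a ord0 i * partial i f x).
Proof.
move=> /near_increment_partials[w near_w] fc.
have ha0 : h *: a @[h --> (0 : R)^'] --> (0 : 'rV[R]_n).
  rewrite -[X in _ --> X](scale0r a).
  by apply: cvgZ; [exact: nbhs_dnbhs|exact: cvg_cst].
have near_wha : \forall h \near 0^',
    (forall i, `|w (h *: a) i| <= `|h *: a|) /\
    f (x + h *: a) - f x =
      \sum_i (h *: a) ord0 i * partial i f (x + w (h *: a) i).
  exact: ha0 near_w.
have quotE : \forall h \near 0^',
    \sum_i a ord0 i * partial i f (x + w (h *: a) i) =
    h^-1 *: ((f \o shift x) (h *: a) - f x).
  have near_neq0 : \forall h \near (0 : R)^', h != 0 by exact: nbhs_dnbhs_neq.
  apply: filterS2 near_wha near_neq0 => h [_ incrE] h0.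
  rewrite /= [h *: a + x]addrC incrE scaler_sumr; apply: eq_bigr => i _.
  by rewrite mxE -[_^-1 *: _]/(_^-1 * _) !mulrA mulVf// mul1r.
apply: cvg_is_derive; apply: cvg_trans (near_eq_cvg quotE) _.
apply: cvg_big => [|i _]; first exact: add_continuous.
apply: cvgM; first exact: cvg_cst.
apply: continuous_cvg; first exact: fc.
apply/cvgrPdist_lt => e e0; have /cvgr0_norm_lt/(_ e e0) := ha0.
apply: filterS2 near_wha => h [wh _]; rewrite opprD addNKr normrN.
exact: le_lt_trans (wh i).
Qed.

Section C2Functions.
Variables (Omega : set 'rV[R]_n) (f : 'rV[R]_n -> R).
Hypothesis f_C2 : C2_on Omega f.
Implicit Types i j : 'I_n.

Lemma C2_on_continuous x : Omega x -> {for x, continuous f}.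
Proof. by case/f_C2. Qed.

Lemma C2_on_derivable x i : Omega x -> derivable f x (evec R i).
Proof. by case/f_C2 => _ /(_ i)[]. Qed.

Lemma C2_on_partial_continuous x i : Omega x ->
  {for x, continuous (partial i f)}.
Proof. by case/f_C2 => _ /(_ i)[_ []]. Qed.

Lemma C2_on_partial_derivable x i j : Omega x ->
  derivable (partial i f) x (evec R j).
Proof. by case/f_C2 => _ /(_ i)[_ [_ /(_ j)[]]]. Qed.

Lemma C2_on_partial2_continuous x i j : Omega x ->
  {for x, continuous (partial j (partial i f))}.
Proof. by case/f_C2 => _ /(_ i)[_ [_ /(_ j)[]]]. Qed.

Hypothesis Omega_open : open Omega.

Lemma C2_on_is_derive x a : Omega x ->
  is_derive x a f (\sum_i a ord0 i * partial i f x).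
Proof.
move=> Ox; apply: is_derive_partials => [|i].
  by apply: filterS (near_open Omega_open Ox) => y Oy i; exact: C2_on_derivable.
exact: C2_on_partial_continuous.
Qed.

Lemma C2_on_is_derive_partial x a i : Omega x ->
  is_derive x a (partial i f) (\sum_j a ord0 j * partial j (partial i f) x).
Proof.
move=> Ox; apply: is_derive_partials => [|j].
  apply: filterS (near_open Omega_open Ox) => y Oy j.
  exact: C2_on_partial_derivable.
exact: C2_on_partial2_continuous.
Qed.

Lemma bform_hessian x a : bform (hessian f x) a a =
  \sum_i a ord0 i * \sum_j a ord0 j * partial j (partial i f) x.
Proof.
rewrite /bform mxE; under eq_bigr => j _ do rewrite !mxE mulr_suml.
rewrite exchange_big/=; apply: eq_bigr => i _; rewrite mulr_sumr.
by apply: eq_bigr => j _; rewrite !mxE; ring.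
Qed.

Lemma local_max_hessian_psd x : Omega x -> (\forall y \near x, f y <= f x) ->
  psd (- hessian f x).
Proof.
move=> Ox fmax a; rewrite -/(bform _ _ _) bformNl oppr_ge0 bform_hessian.
pose dg t := \sum_i a ord0 i * partial i f (x + t *: a).
apply: (@local_max_second_derivative_le0 R (fun t => f (x + t *: a)) dg 0).
- have : \forall t \near (0 : R), Omega (x + t *: a).
    exact: cvg_line (near_open Omega_open Ox).
  apply: filterS => t Ot; have [fd fdE] := C2_on_is_derive a Ot.
  by rewrite /dg -fdE; exact: is_derive_line.
- have -> : dg = \sum_i (a ord0 i \*: (fun t => partial i f (x + t *: a))).
    by apply/funext => t; rewrite fct_sumE.
  apply: is_derive_sum => i; apply: is_deriveZ.
  have [pd <-] := C2_on_is_derive_partial a i Ox.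
  have := @is_derive_line _ _ (partial i f) x a 0.
  by rewrite scale0r addr0 => /(_ pd).
- by rewrite scale0r addr0; exact: cvg_line fmax.
Qed.

End C2Functions.
End PartialDerivatives.

Section SymmetryOfSecondDerivatives.
Context {R : realType} {n : nat}.
Variables (Omega : set 'rV[R]_n) (f : 'rV[R]_n -> R).
Hypotheses (Omega_open : open Omega) (f_C2 : C2_on Omega f).
Implicit Types (x y z : 'rV[R]_n).

Lemma norm_evec_le1 (i : 'I_n) : `|evec R i| <= 1.
Proof.
apply/mx_norm_leP => // j; rewrite mxE eqxx/=.
by case: eqP => _; rewrite ?normr1 ?normr0.
Qed.

Lemma mixed_increment x (i j : 'I_n) (s : R) : 0 <= s ->
  (forall y, `|y - x| <= 2 * s -> Omega y) ->
  exists2 z, `|z - x| <= 2 * s &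
    f (x + s *: evec R i + s *: evec R j) - f (x + s *: evec R i) -
    (f (x + s *: evec R j) - f x) = s ^+ 2 * partial j (partial i f) z.
Proof.
move=> s0 ballO; pose k y := f (y + s *: evec R j) - f y.
have sE : `|s| = s by rewrite ger0_norm.
have close (p q : R) : `|p| <= s -> `|q| <= s ->
    `|x + p *: evec R i + q *: evec R j - x| <= 2 * s.
  move=> ps qs; rewrite -[x + _ + _]addrA [x + _]addrC addrK.
  rewrite (le_trans (ler_normD _ _))// !normrZ.
  by rewrite mulr_natl mulr2n lerD// -[leRHS]mulr1 ler_pM ?norm_evec_le1.
have close1 (p : R) : `|p| <= s -> `|x + p *: evec R i - x| <= 2 * s.
  by move=> ps; have := close p 0 ps; rewrite normr0 scale0r addr0; exact.
have kD (p : R) : `|p| <= s -> is_derive (x + p *: evec R i) (evec R i) k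
    (partial i f (x + p *: evec R i + s *: evec R j) -
     partial i f (x + p *: evec R i)).
  move=> ps; apply: is_deriveB.
    apply: is_derive_translate; apply: (C2_on_derivable f_C2).
    by apply: ballO; apply: close; rewrite ?sE.
  by apply: derivableP; apply: (C2_on_derivable f_C2); exact/ballO/close1.
have [p|p ps kE] := @MVT_line R _ k x (evec R i) s.
  by rewrite sE => /kD[].
rewrite sE in ps; have [_ kpE] := kD p ps.
have [q|q qs ikE] :=
    @MVT_line R _ (partial i f) (x + p *: evec R i) (evec R j) s.
  by rewrite sE => qs; apply: (C2_on_partial_derivable f_C2); exact/ballO/close.
rewrite sE in qs.
exists (x + p *: evec R i + q *: evec R j); first exact: close.
by rewrite expr2 -mulrA -ikE -kpE -kE.
Qed.

Lemma partial_comm_le x (i j : 'I_n) : Omega x ->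
  partial j (partial i f) x <= partial i (partial j f) x.
Proof.
move=> Ox; rewrite leNgt; apply/negP => /midf_lt.
set m := _ / 2 => -[mj mi].
have : \forall y \near x, [/\ Omega y, partial i (partial j f) y < m &
    m < partial j (partial i f) y].
  near=> y; split; near: y; first exact: near_open Omega_open Ox.
    move: (C2_on_partial2_continuous f_C2 (i := j) (j := i) Ox).
    by move/cvgr_lt; apply.
  move: (C2_on_partial2_continuous f_C2 (i := i) (j := j) Ox).
  by move/cvgr_gt; apply.
move=> /nbhs_normP[d /= d0 near_x]; pose s := d / 4.
have s0 : 0 < s by rewrite divr_gt0.
have ball_d y : `|y - x| <= 2 * s -> `|x - y| < d.
  move=> yx; rewrite distrC (le_lt_trans yx)// /s.
  by rewrite mulrA ltr_pdivrMr// mulrC ltr_pM2l// ltr_nat.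
have ballO y : `|y - x| <= 2 * s -> Omega y by move=> /ball_d/near_x[].
have [z /ball_d/near_x[_ _ mz] zE] := @mixed_increment x i j s (ltW s0) ballO.
have [w /ball_d/near_x[_ wm _] wE] := @mixed_increment x j i s (ltW s0) ballO.
have s2 : 0 < s ^+ 2 by rewrite exprn_gt0.
have : s ^+ 2 * partial j (partial i f) z = s ^+ 2 * partial i (partial j f) w.
  apply: etrans (esym zE) (etrans _ wE); rewrite [x + _ + _]addrAC.
  by move: (f _) (f _) (f _) (f _) => b1 b2 b3 b4; ring.
move/(mulfI (lt0r_neq0 s2)) => zw.
by have := lt_trans wm mz; rewrite zw ltxx.
Unshelve. all: end_near. Qed.

Lemma hessian_symmx x : Omega x -> symmx (hessian f x).
Proof.
move=> Ox; apply/matrixP => i j; rewrite !mxE.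
by apply/le_anti/andP; split; exact: partial_comm_le.
Qed.

End SymmetryOfSecondDerivatives.

Lemma near_eq_continuous_at (T U : topologicalType) (h k : T -> U) (x : T) :
  (\forall y \near x, h y = k y) ->
  {for x, continuous h} -> {for x, continuous k}.
Proof.
move=> hk hc; rewrite /prop_for /continuous_at -(nbhs_singleton hk).
exact: cvg_trans (near_eq_cvg hk) hc.
Qed.

Lemma continuous_at_sum (R : realType) (T : topologicalType) (I : Type)
    (r : seq I) (f : I -> T -> R) (x : T) :
  (forall i, {for x, continuous (f i)}) ->
  {for x, continuous (fun y => \sum_(i <- r) f i y)}.
Proof.
by move=> fc; apply: cvg_big => [|i _]; [exact: add_continuous|exact: fc].
Qed.

Section LinearityOfTheHessian.
Context {R : realType} {n : nat}.
Variables (Omega : set 'rV[R]_n) (a : R) (f g : 'rV[R]_n -> R).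
Hypothesis Omega_open : open Omega.
Hypotheses (f_C2 : C2_on Omega f) (g_C2 : C2_on Omega g).
Implicit Types (x : 'rV[R]_n) (i j : 'I_n).

Lemma continuous_at_linear (T : topologicalType) (h k : T -> R) (x : T) :
  {for x, continuous h} -> {for x, continuous k} ->
  {for x, continuous (a *: h + k)}.
Proof.
by move=> hc kc; apply: continuousD kc; apply: cvgZ hc; exact: cvg_cst.
Qed.

Lemma is_derive_linear (h k : 'rV[R]_n -> R) x i :
  derivable h x (evec R i) -> derivable k x (evec R i) ->
  is_derive x (evec R i) (a *: h + k) ((a *: partial i h + partial i k) x).
Proof.
by move=> hd kd; apply: is_deriveD; [apply: is_deriveZ|]; exact: derivableP.
Qed.

Lemma near_partial_linear x i : Omega x -> \forall y \near x,
  (a *: partial i f + partial i g) y = partial i (a *: f + g) y.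
Proof.
move=> Ox; apply: filterS (near_open Omega_open Ox) => y Oy.
have fd := C2_on_derivable f_C2 (i := i) Oy.
have gd := C2_on_derivable g_C2 (i := i) Oy.
by have [_ <-] := is_derive_linear fd gd.
Qed.

Lemma is_derive_partial_linear x i j : Omega x ->
  is_derive x (evec R j) (partial i (a *: f + g))
    ((a *: partial j (partial i f) + partial j (partial i g)) x).
Proof.
move=> Ox; apply: near_eq_is_derive (near_partial_linear i Ox) _.
apply: is_derive_linear; first exact: (C2_on_partial_derivable f_C2).
exact: (C2_on_partial_derivable g_C2).
Qed.

Lemma C2_on_linear : C2_on Omega (a *: f + g).
Proof.
move=> x Ox; split=> [|i].
  apply: continuous_at_linear; first exact: (C2_on_continuous f_C2).
  exact: (C2_on_continuous g_C2).
split.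
  have fd := C2_on_derivable f_C2 (i := i) Ox.
  have gd := C2_on_derivable g_C2 (i := i) Ox.
  by have [] := is_derive_linear fd gd.
split=> [|j].
  apply: near_eq_continuous_at (near_partial_linear i Ox) _.
  apply: continuous_at_linear; first exact: (C2_on_partial_continuous f_C2).
  exact: (C2_on_partial_continuous g_C2).
split; first by have [] := is_derive_partial_linear i j Ox.
have fc := C2_on_partial2_continuous f_C2 (i := i) (j := j) Ox.
have gc := C2_on_partial2_continuous g_C2 (i := i) (j := j) Ox.
apply: near_eq_continuous_at (continuous_at_linear fc gc).
apply: filterS (near_open Omega_open Ox) => y Oy.
by have [_ <-] := is_derive_partial_linear i j Oy.
Qed.

Lemma hessian_linear x : Omega x ->
  hessian (a *: f + g) x = a *: hessian f x + hessian g x.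
Proof.
move=> Ox; apply/matrixP => i j.
rewrite [LHS]mxE [RHS]mxE [hessian g x i j]mxE [(a *: hessian f x) i j]mxE.
rewrite [hessian f x i j]mxE.
by have [_] := is_derive_partial_linear i j Ox.
Qed.

End LinearityOfTheHessian.

(** * Euclidean balls and closest points *)

Section EuclideanBalls.
Context {R : realType} {n : nat}.
Implicit Types (x y z : 'rV[R]_n) (r t : R).

Definition sqnorm x : R := \sum_i x ord0 i ^+ 2.
Definition dotrv x y : R := \sum_i x ord0 i * y ord0 i.

Lemma sqnorm_ge0 x : 0 <= sqnorm x.
Proof. by apply: sumr_ge0 => i _; exact: sqr_ge0. Qed.

Lemma sqnorm0 : sqnorm 0 = 0.
Proof. by apply: big1 => i _; rewrite mxE expr0n. Qed.

Lemma sqnorm_eq0 x : (sqnorm x == 0) = (x == 0).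
Proof.
apply/eqP/eqP => [/eqP|->]; last exact: sqnorm0.
rewrite psumr_eq0 => [/allP x0|i _]; last exact: sqr_ge0.
apply/rowP => i; rewrite mxE; apply/eqP; rewrite -sqrf_eq0.
by apply: x0; rewrite mem_index_enum.
Qed.

Lemma dotrvv x : dotrv x x = sqnorm x.
Proof. by apply: eq_bigr => i _; rewrite expr2. Qed.

Lemma sqnormD x y t :
  sqnorm (x + t *: y) = sqnorm x + 2 * t * dotrv x y + t ^+ 2 * sqnorm y.
Proof.
rewrite /sqnorm /dotrv !mulr_sumr -!big_split/=; apply: eq_bigr => i _.
by rewrite !mxE; ring.
Qed.

Lemma norm_le_sqnorm x : `|x| ^+ 2 <= sqnorm x.
Proof.
have [->|x0] := eqVneq x 0; first by rewrite normr0 expr0n sqnorm_ge0.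
have [[k j] ->] : exists ij, `|x| = `|x ij.1 ij.2|.
  by apply: mx_norm_neq0; rewrite -[mx_norm x]/(`|x|) normr_eq0.
rewrite /= ord1 real_normK ?num_real// /sqnorm (bigD1 j)//= lerDl.
by apply: sumr_ge0 => i _; exact: sqr_ge0.
Qed.

Definition sqdist z x : R := sqnorm (x - z).

Definition eball z r : set 'rV[R]_n := [set x | sqdist z x < r ^+ 2].
Definition closed_eball z r : set 'rV[R]_n := [set x | sqdist z x <= r ^+ 2].
Definition esphere z r : set 'rV[R]_n := [set x | sqdist z x = r ^+ 2].

Lemma sqdist_ge0 z x : 0 <= sqdist z x.
Proof. exact: sqnorm_ge0. Qed.

Lemma sqdistxx z : sqdist z z = 0.
Proof. by rewrite /sqdist subrr sqnorm0. Qed.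

Lemma continuous_sqdist z : continuous (sqdist z).
Proof.
apply: continuous_big => [|i _ x]; first exact: add_continuous.
have coordB : {for x, continuous (fun y : 'rV[R]_n => (y - z) ord0 i)}.
  have -> : (fun y => (y - z) ord0 i) = (fun y => y ord0 i) \- cst (z ord0 i).
    by apply/funext => y; rewrite !mxE.
  by apply: continuousB; [exact: coord_continuous|exact: cst_continuous].
exact: (continuousM coordB coordB).
Qed.

Lemma open_eball z r : open (eball z r).
Proof.
apply: (@open_comp _ _ (sqdist z) [set c | c < r ^+ 2]).
  by move=> x _; exact: continuous_sqdist.
exact: open_lt.
Qed.

Lemma near_eball z r x : eball z r x -> \forall y \near x, eball z r y.
Proof. by move=> xr; apply: open_nbhs_nbhs; split; first exact: open_eball. Qed.

Lemma eball_center z r : 0 < r -> eball z r z.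
Proof. by move=> r0; rewrite /eball/= sqdistxx exprn_gt0. Qed.

Lemma closed_closed_eball z r : closed (closed_eball z r).
Proof.
apply: (@closed_comp _ _ (sqdist z) [set c | c <= r ^+ 2]).
  by move=> x _; exact: continuous_sqdist.
exact: closed_le.
Qed.

Lemma closed_eball_center z r : closed_eball z r z.
Proof. by rewrite /closed_eball/= sqdistxx sqr_ge0. Qed.

Lemma sub_eball_closed_eball z r : eball z r `<=` closed_eball z r.
Proof. by move=> x /ltW. Qed.

Lemma sub_esphere_closed_eball z r : esphere z r `<=` closed_eball z r.
Proof. by move=> x; rewrite /closed_eball/= => ->. Qed.

Lemma closed_eball_split z r x :
  closed_eball z r x -> eball z r x \/ esphere z r x.
Proof. by rewrite /closed_eball/= le_eqVlt => /orP[/eqP|]; [right|left]. Qed.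

Lemma closed_eball_norm z r x : 0 <= r -> closed_eball z r x -> `|x - z| <= r.
Proof.
move=> r0 xr; rewrite -(@ler_pXn2r _ 2)// ?nnegrE//.
exact: le_trans (norm_le_sqnorm _) xr.
Qed.

Lemma compact_closed_eball z r : compact (closed_eball z r).
Proof.
apply: bounded_closed_compact; last exact: closed_closed_eball.
exists (`|z| + `|r|); split; first exact: num_real.
move=> m mz x /= xr; apply: le_trans (ltW mz).
rewrite -[x](subrK z) addrC (le_trans (ler_normD _ _))// lerD2l.
by apply: closed_eball_norm; rewrite // /closed_eball/= real_normK ?num_real.
Qed.

Lemma nbhs_closed_eball z (U : set 'rV[R]_n) : nbhs z U ->
  exists2 r, 0 < r & closed_eball z r `<=` U.
Proof.
move=> /nbhs_normP[d /= d0 dU]; exists (d / 2); first by rewrite divr_gt0.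
move=> x /closed_eball_norm xd; apply: dU; rewrite /ball_/= distrC.
rewrite (le_lt_trans (xd _))// ?divr_ge0 ?ltW//.
by rewrite ltr_pdivrMr// ltr_pMr// ltr1n.
Qed.

Lemma B1_eball : @B1 R n = eball 0 1.
Proof.
apply/funext => x; rewrite /B1 /eball/= /sqdist subr0 expr1n.
by rewrite -[enorm x]/(Num.sqrt (sqnorm x)) -{1}(sqrtr1 R) ltr_sqrt.
Qed.

End EuclideanBalls.

Section ClosestPoint.
Context {R : realType} {n : nat}.
Implicit Types (K : set 'rV[R]_n) (p y z : 'rV[R]_n).

Lemma convex_set_lmodP (V : lmodType R) (K : set V) : convex_set K <->
  forall (x y : V) (t : R), K x -> K y -> 0 <= t <= 1 ->
    K (t *: x + (1 - t) *: y).
Proof.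
split=> [Kconv x y t Kx Ky /andP[t0 t1]|Kconv x y t].
  by have := Kconv x y (Itv01 t0 t1); rewrite !inE; exact.
by rewrite !inE => Kx Ky; apply: Kconv => //; apply/andP; split.
Qed.

Lemma closest_point_exists K z : closed K -> K !=set0 ->
  exists2 p, K p & forall y, K y -> sqdist z p <= sqdist z y.
Proof.
move=> Kclosed [y0 Ky0]; pose r := Num.sqrt (sqdist z y0).
have rE : r ^+ 2 = sqdist z y0 by rewrite sqr_sqrtr// sqdist_ge0.
pose S := closed_eball z r `&` K.
have S_compact : compact S.
  by apply: compact_closedI => //; exact: compact_closed_eball.
have S_neq0 : S !=set0 by exists y0; split=> //; rewrite /closed_eball/= rE.
have [|p] := @EVT_min_rV R n (sqdist z) S S_neq0 S_compact.
  by apply: continuous_subspaceT; exact: continuous_sqdist.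
rewrite inE => -[pr Kp] pmin; exists p => // y Ky.
have [yr|/ltW] := leP (sqdist z y) (r ^+ 2); first by apply: pmin; rewrite inE.
exact: le_trans.
Qed.

Lemma closest_point_dotrv_ge0 K z p : convex_set K -> K p ->
  (forall y, K y -> sqdist z p <= sqdist z y) ->
  forall y, K y -> 0 <= dotrv (p - z) (y - p).
Proof.
move=> /convex_set_lmodP Kconv Kp pmin y Ky.
set D := dotrv _ _; set S := sqnorm (y - p).
have quad_ge0 (t : R) : 0 < t <= 1 -> 0 <= 2 * D + t * S.
  move=> /andP[t0 t1]; have := pmin _ (Kconv y p t Ky Kp _).
  rewrite t1 (ltW t0) /sqdist => /(_ isT).
  have -> : t *: y + (1 - t) *: p - z = p - z + t *: (y - p).
    by apply/rowP => i; rewrite !mxE; ring.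
  rewrite sqnormD -/D -/S -addrA lerDl.
  have -> : 2 * t * D + t ^+ 2 * S = t * (2 * D + t * S) by ring.
  by rewrite pmulr_rge0.
have S0 : 0 <= S := sqnorm_ge0 _.
rewrite leNgt; apply/negP => D0; have SD : 0 < S - D by lra.
have := quad_ge0 (- D / (S - D)).
rewrite divr_gt0 ?oppr_gt0// ler_pdivrMr// mul1r lerDr => /(_ S0).
have tSD : - D / (S - D) * (S - D) = - D by rewrite divfK// gt_eqF.
have : 0 < - D / (S - D) by rewrite divr_gt0// oppr_gt0.
by nra.
Qed.

End ClosestPoint.

(** * Separation from a superlevel set *)

Section Separation.
Context {R : realType} {n : nat}.
Implicit Types (A M N : 'M[R]_n) (K : set 'M[R]_n) (F : 'M[R]_n -> R).

Definition affine_op A (c : R) M : R := \tr (A *m M) - c.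

Definition degenerate_elliptic F : Prop :=
  forall M N, symmx M -> symmx N -> psd N -> F M <= F (M + N).

Lemma symmxD M N : symmx M -> symmx N -> symmx (M + N).
Proof. by move=> Ms Ns; rewrite /symmx linearD/= Ms Ns. Qed.

Lemma symmxB M N : symmx M -> symmx N -> symmx (M - N).
Proof. by move=> Ms Ns; rewrite /symmx linearB/= Ms Ns. Qed.

Lemma symmxZ (a : R) M : symmx M -> symmx (a *: M).
Proof. by move=> Ms; rewrite /symmx linearZ/= Ms. Qed.

Lemma degenerate_elliptic_le F M N : degenerate_elliptic F ->
  symmx M -> symmx N -> psd (N - M) -> F M <= F N.
Proof.
move=> Fell Ms Ns NMp; rewrite -[in leRHS](subrK M N) [N - M + M]addrC.
by apply: Fell => //; exact: symmxB.
Qed.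

Lemma degenerate_elliptic_affine_op A (c : R) : symmx A -> psd A ->
  degenerate_elliptic (affine_op A c).
Proof.
move=> As Ap M N _ _ Np; rewrite /affine_op mulmxDr mxtraceD lerD2r lerDl.
exact: psd_mxtrace_mul_ge0.
Qed.

Lemma opnorm_ge0 N : 0 <= opnorm N.
Proof.
rewrite /opnorm; set S := image _ _.
have [[[y Sy] S_ub]|S_nsup] := pselect (has_sup S); last by rewrite sup_out.
by apply: le_trans (ub_le_sup S_ub Sy); case: Sy => x _ <-; exact: sqrtr_ge0.
Qed.

Lemma unif_elliptic_degenerate F (lam Lam : R) :
  unif_elliptic F lam Lam -> degenerate_elliptic F.
Proof.
move=> [lam0 [_ Fell]] M N Ms Ns Np; have [FMN _] := Fell M N Ms Ns Np.
by rewrite -subr_ge0 (le_trans _ FMN)// mulr_ge0 ?opnorm_ge0 ?ltW.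
Qed.

Lemma dotrv_mxvec A M : symmx A -> dotrv (mxvec A) (mxvec M) = \tr (A *m M).
Proof.
move=> As; rewrite /dotrv (reindex _ (curry_mxvec_bij n n))/=.
rewrite /mxtrace; under [RHS]eq_bigr => i _ do rewrite mxE.
rewrite exchange_big pair_big/=; apply: eq_bigr => -[i j] _ /=.
by rewrite !mxvecE -{1}As mxE.
Qed.

Lemma continuous_vec_mx : continuous (@vec_mx R n n).
Proof.
move=> v s /nbhs_ballP[e e0 es]; apply/nbhs_ballP; exists e => // w [_ vw].
by apply: es; split => // i j; rewrite !mxE; exact: vw.
Qed.

Lemma closest_symmx K M0 : closed K -> K !=set0 -> K `<=` @symmx R n ->
  convex_set K -> symmx M0 ->
  exists2 M1, K M1 & forall N, K N -> 0 <= \tr ((M1 - M0) *m (N - M1)).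
Proof.
move=> Kclosed [M KM] Ks /convex_set_lmodP Kconv M0s; pose vK := vec_mx @^-1` K.
have vK_closed : closed vK.
  by apply: preimage_closed => // v _; exact: continuous_vec_mx.
have vK_neq0 : vK !=set0 by exists (mxvec M); rewrite /vK/= mxvecK.
have vK_conv : convex_set vK.
  apply/convex_set_lmodP => x y t Kx Ky t01.
  by rewrite /vK/= linearD/= !linearZ/=; exact: Kconv.
have [p Kp pmin] := closest_point_exists (mxvec M0) vK_closed vK_neq0.
exists (vec_mx p) => // N KN.
rewrite -dotrv_mxvec; last by apply: symmxB => //; exact: Ks.
rewrite !raddfB/= vec_mxK; apply: closest_point_dotrv_ge0 vK_conv Kp pmin _ _.
by rewrite /vK/= mxvecK.
Qed.

Lemma psd_separation K M0 :
  closed K -> K !=set0 -> K `<=` @symmx R n -> convex_set K ->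
  (forall M N, K M -> symmx N -> psd N -> K (M + N)) -> symmx M0 -> ~ K M0 ->
  exists A (c : R), [/\ symmx A, psd A, A != 0,
    forall M, K M -> 0 <= affine_op A c M & affine_op A c M0 < 0].
Proof.
move=> Kclosed K_neq0 Ks Kconv Kup M0s KM0.
have [M1 KM1 M1min] := closest_symmx Kclosed K_neq0 Ks Kconv M0s.
pose A := M1 - M0.
have As : symmx A by apply: symmxB => //; exact: Ks.
have A0 : A != 0 by apply: contra_notN KM0; rewrite subr_eq0 => /eqP <-.
exists A, (\tr (A *m M1)); split => //.
- move=> x; have := M1min _ (Kup _ _ KM1 (symmx_gram x) (psd_gram x)).
  by rewrite [M1 + x^T *m x]addrC addrK mulmxA mxtrace_mulC mulmxA trace_mx11.
- by move=> N /M1min; rewrite mulmxBr raddfB.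
- rewrite /affine_op -raddfB/= -mulmxBr -opprB -/A mulmxN raddfN/= oppr_lt0.
  rewrite -dotrv_mxvec// dotrvv lt_def sqnorm_ge0 sqnorm_eq0 andbT.
  by apply: contra_neq A0 => vA0; rewrite -(mxvecK A) vA0 linear0.
Qed.

Lemma closed_symmx : closed (@symmx R n).
Proof.
move=> M Mcl; apply/matrixP => i j; rewrite mxE.
apply/eqP; rewrite -subr_eq0; apply/eqP.
pose g (N : 'M[R]_n) : R := N j i - N i j.
have g0_closed : closed (g @^-1` [set 0]).
  apply: preimage_closed; last exact: closed_eq.
  by move=> N _; apply: continuousB; exact: coord_continuous.
apply: g0_closed; apply: closure_subset Mcl => N Ns.
by rewrite /g/= -{1}Ns mxE subrr.
Qed.

Lemma superlevel_separation F M0 : {within @symmx R n, continuous F} ->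
  quasiconcave F -> degenerate_elliptic F -> (exists2 M, symmx M & 0 <= F M) ->
  symmx M0 -> F M0 < 0 ->
  exists A (c : R), [/\ symmx A, psd A, A != 0,
    forall M, symmx M -> 0 <= F M -> 0 <= affine_op A c M &
    affine_op A c M0 < 0].
Proof.
move=> Fc Fq Fell [M Ms FM] M0s FM0.
pose K := @symmx R n `&` [set M | 0 <= F M].
have K_closed : closed K.
  rewrite closed_setSI; last exact: closed_symmx.
  by have /continuous_closedP/(_ _ (@closed_ge R 0)) := Fc.
have K_neq0 : K !=set0 by exists M.
have K_conv : convex_set K.
  apply/convex_set_lmodP => N P t [Ns FN] [Ps FP] t01.
  split; first by apply: symmxD; exact: symmxZ.
  by apply: le_trans (Fq _ _ _ Ns Ps t01); rewrite le_min; apply/andP.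
have Kup N P : K N -> symmx P -> psd P -> K (N + P).
  move=> [Ns FN] Ps Pp; split; first exact: symmxD.
  exact: le_trans FN (Fell _ _ Ns Ps Pp).
have KM0 : ~ K M0 by move=> [_]/=; rewrite leNgt FM0.
have [A [c [As Ap A0 Ac AM0]]] :=
  psd_separation K_closed K_neq0 (@subIsetl _ _ _) K_conv Kup M0s KM0.
by exists A, c; split => // N Ns FN; exact: Ac.
Qed.

End Separation.

(** * Polynomial functions *)

Section InjectiveOnFiniteSpan.
Context {K : fieldType} {V : lmodType K}.

Lemma fin_span_dependent (I : finType) (m : I -> V) (v : nat -> V) :
  (forall k, exists a : I -> K, v k = \sum_i a i *: m i) ->
  exists2 c : nat -> K, exists2 k, (k < #|I|.+1)%N & c k != 0 &
    \sum_(k < #|I|.+1) c k *: v k = 0.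
Proof.
move=> /choice[a vE].
pose M : 'M[K]_(#|I|.+1, #|I|) := \matrix_(k, l) a k (enum_val l).
have : kermx M != 0.
  by rewrite -mxrank_eq0 mxrank_ker subn_eq0 -ltnNge ltnS rank_leq_col.
move=> /rowV0Pn[c /sub_kermxP cM c0]; exists (fun k => c ord0 (inord k)).
  move: c0 => /rV0Pn[k ck]; exists k; [exact: ltn_ord|by rewrite inord_val].
under eq_bigr => k _ do rewrite inord_val vE scaler_sumr.
rewrite exchange_big big1// => i _ /=.
under eq_bigr => k _ do rewrite scalerA.
rewrite -scaler_suml [X in X *: _](_ : _ = 0) ?scale0r//.
have /rowP/(_ (enum_rank i)) := cM; rewrite !mxE => cM_i; rewrite -[RHS]cM_i.
by apply: eq_bigr => k _; rewrite mxE enum_rankK.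
Qed.

Variables (P : set V) (T : V -> V).
Hypotheses (P0 : P 0) (P_linear : forall a f g, P f -> P g -> P (a *: f + g)).
Hypothesis PT : forall f, P f -> P (T f).
Hypothesis T_linear :
  forall a f g, P f -> P g -> T (a *: f + g) = a *: T f + T g.
Hypothesis T_inj : forall f, P f -> T f = 0 -> f = 0.

Let T0 : T 0 = 0.
Proof.
by have := T_linear (-1) P0 P0; rewrite scaler0 addr0 scaleN1r addNr.
Qed.

Let PZ a f : P f -> P (a *: f).
Proof. by move=> Pf; rewrite -[a *: f]addr0; exact: P_linear. Qed.

Let TZ a f : P f -> T (a *: f) = a *: T f.
Proof. by move=> Pf; rewrite -[a *: f]addr0 T_linear// T0 addr0. Qed.

Lemma linear_on_sum N (a : nat -> K) (f : nat -> V) : (forall k, P (f k)) ->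
  P (\sum_(k < N) a k *: f k) /\
  T (\sum_(k < N) a k *: f k) = \sum_(k < N) a k *: T (f k).
Proof.
move=> Pf; elim: N => [|N [Psum Tsum]]; first by rewrite !big_ord0.
rewrite !big_ord_recr/= addrC; split; first exact: P_linear.
by rewrite T_linear// Tsum addrC.
Qed.

(* Cancelling [T] by injectivity, we may assume that the constant coefficient
   of the relation is nonzero; it then exhibits [g] as a value of [T]. *)
Lemma iter_relation_surj N (a : nat -> K) g : P g ->
  (exists2 k, (k < N)%N & a k != 0) -> \sum_(k < N) a k *: iter k T g = 0 ->
  exists2 f, P f & T f = g.
Proof.
move=> Pg; have Piter k : P (iter k T g) by elim: k => //= k; exact: PT.
elim: N a => [|N IHN] a [k kN ak]; first by [].
have [Psum Tsum] := linear_on_sum N (fun k => a k.+1) Piter.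
rewrite big_ord_recl/= -Tsum; have [a0|a0] := eqVneq (a 0%N) 0.
  rewrite a0 scale0r add0r => /(T_inj Psum); apply: (IHN (fun k => a k.+1)).
  by case: k kN ak => [|k] kN ak; [rewrite a0 eqxx in ak|exists k].
move=> /eqP; rewrite addrC addr_eq0 => /eqP TsumE.
exists (- (a 0%N)^-1 *: \sum_(k < N) a k.+1 *: iter k T g); first exact: PZ.
by rewrite TZ// TsumE scaleNr scalerN opprK scalerA mulVf// scale1r.
Qed.

Lemma fin_span_inj_surj (I : finType) (m : I -> V) :
  (forall f, P f -> exists a : I -> K, f = \sum_k a k *: m k) ->
  forall g, P g -> exists2 f, P f & T f = g.
Proof.
move=> P_span g Pg.
have Piter k : P (iter k T g) by elim: k => //= k; exact: PT.
have [c c_neq0] := fin_span_dependent (fun k => P_span _ (Piter k)).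
exact: iter_relation_surj c_neq0.
Qed.

End InjectiveOnFiniteSpan.

Section PolynomialFunctions.
Context {R : realType} {n : nat}.
Implicit Types (f g : 'rV[R]_n -> R) (x y z : 'rV[R]_n).
Implicit Types (i j : 'I_n) (d e : nat).

Definition coord i : 'rV[R]_n -> R := fun x => x ord0 i.

(* The functions which are polynomials of total degree at most [d]. *)
Fixpoint polyfun d : set ('rV[R]_n -> R) :=
  if d is d'.+1 then
    [set f | exists g0 (g : 'I_n -> 'rV[R]_n -> R),
      [/\ polyfun d' g0, forall i, polyfun d' (g i) &
          f = g0 + \sum_i coord i * g i]]
  else range cst.

Lemma polyfunS d f : polyfun d f -> polyfun d.+1 f.
Proof.
have polyfun_cst0 : polyfun d (cst 0).
  elim: d {f} => [|d IHd]; first by exists 0.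
  exists (cst 0), (fun=> cst 0); split => //.
  by rewrite big1 ?addr0// => i _; exact: mulr0.
move=> Pf; exists f, (fun=> cst 0); split => //.
by rewrite big1 ?addr0// => i _; exact: mulr0.
Qed.

Lemma polyfun_le d e f : (d <= e)%N -> polyfun d f -> polyfun e f.
Proof.
by move=> /subnK <-; elim: (e - d)%N => //= k IHk /IHk; exact: polyfunS.
Qed.

Lemma polyfun_cst d c : polyfun d (cst c).
Proof. by apply: (@polyfun_le 0) => //; exists c. Qed.

Lemma polyfunD d f g : polyfun d f -> polyfun d g -> polyfun d (f + g).
Proof.
elim: d f g => [|d IHd] f g; first by move=> [a _ <-] [b _ <-]; exists (a + b).
move=> [f0 [fi [Pf0 Pfi ->]]] [g0 [gi [Pg0 Pgi ->]]].
exists (f0 + g0), (fun i => fi i + gi i).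
split=> [|i|]; [exact: IHd|exact: IHd (Pfi i) (Pgi i)|].
rewrite addrACA -big_split/=; congr (_ + _).
by apply: eq_bigr => i _; rewrite mulrDr.
Qed.

Lemma polyfunZ d (a : R) f : polyfun d f -> polyfun d (a *: f).
Proof.
elim: d f => [|d IHd] f; first by move=> [b _ <-]; exists (a * b).
move=> [f0 [fi [Pf0 Pfi ->]]].
exists (a *: f0), (fun i => a *: fi i).
split=> [|i|]; [exact: IHd|exact: IHd (Pfi i)|].
rewrite scalerDr scaler_sumr; congr (_ + _); apply: eq_bigr => i _.
by rewrite -![a *: _]/(cst a * _) mulrCA.
Qed.

Lemma polyfun_linear d (a : R) f g :
  polyfun d f -> polyfun d g -> polyfun d (a *: f + g).
Proof. by move=> Pf Pg; apply: polyfunD Pg; exact: polyfunZ. Qed.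

Lemma polyfun_sum d (I : Type) (r : seq I) (f : I -> 'rV[R]_n -> R) :
  (forall k, polyfun d (f k)) -> polyfun d (\sum_(k <- r) f k).
Proof.
by move=> Pf; elim/big_ind: _ => [||//]; [exact: polyfun_cst|exact: polyfunD].
Qed.

Lemma polyfunM d e f g : polyfun d f -> polyfun e g -> polyfun (d + e) (f * g).
Proof.
move=> + Pg; elim: d f => [|d IHd] f; first by move=> [a _ <-]; exact: polyfunZ.
move=> [f0 [fi [Pf0 Pfi ->]]].
exists (f0 * g), (fun i => fi i * g).
split=> [|i|]; [exact: IHd|exact: IHd (Pfi i)|].
rewrite mulrDl mulr_suml; congr (_ + _).
by apply: eq_bigr => i _; rewrite mulrA.
Qed.

Lemma polyfun_coord i : polyfun 1 (coord i).
Proof.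
exists (cst 0), (fun j => cst (j == i)%:R).
split=> [|j|]; [exact: polyfun_cst..|].
rewrite add0r (bigD1 i)//= eqxx big1 ?addr0 => [|j /negbTE ->].
  by rewrite -[LHS]mulr1.
exact: mulr0.
Qed.

Lemma sqdistE z : sqdist z = \sum_i (coord i - cst (z ord0 i)) ^+ 2.
Proof.
by apply/funext => x; rewrite fct_sumE; apply: eq_bigr => i _; rewrite !mxE.
Qed.

Lemma polyfun_sqdist z : polyfun 2 (sqdist z).
Proof.
rewrite sqdistE; apply: polyfun_sum => i; rewrite expr2; apply: (@polyfunM 1 1).
  by apply: polyfunD; [exact: polyfun_coord|exact: (polyfun_cst _ (- _))].
by apply: polyfunD; [exact: polyfun_coord|exact: (polyfun_cst _ (- _))].
Qed.

Lemma polyfun_continuous d f : polyfun d f -> continuous f.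
Proof.
elim: d f => [|d IHd] f; first by move=> [c _ <-]; exact: cst_continuous.
move=> [g0 [g [/IHd g0c Pg ->]]] x; apply: continuousD; first exact: g0c.
rewrite fct_sumE; apply: continuous_big => [|i _ {}x].
  exact: add_continuous.
by apply: continuousM; [exact: coord_continuous|exact: (IHd _ (Pg i))].
Qed.

Lemma is_derive_coord x i j : is_derive x (evec R j) (coord i) (i == j)%:R.
Proof.
apply: cvg_is_derive; apply: cvg_near_cst; near=> h.
rewrite /coord/= !mxE addrK eqxx/= eq_sym -[_ *: _]/(_ * _) mulrA.
rewrite mulVf ?mul1r//.
by near: h; exact: nbhs_dnbhs_neq.
Unshelve. all: end_near. Qed.

Lemma is_derive_coord_expansion (g0 : 'rV[R]_n -> R)
    (g : 'I_n -> 'rV[R]_n -> R) i x :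
  derivable g0 x (evec R i) -> (forall j, derivable (g j) x (evec R i)) ->
  is_derive x (evec R i) (g0 + \sum_j coord j * g j)
    (partial i g0 x + (g i x + \sum_j coord j x * partial i (g j) x)).
Proof.
move=> g0d gd; apply: is_deriveD; first exact: (derivableP g0d).
have -> : g i x + \sum_j coord j x * partial i (g j) x =
    \sum_j (coord j x *: partial i (g j) x + g j x *: (j == i)%:R).
  rewrite big_split/= addrC; congr (_ + _).
  rewrite (bigD1 i)//= eqxx big1 ?addr0 => [|j /negbTE ->]; last exact: mulr0.
  by rewrite [_ *: _]mulr1.
apply: is_derive_sum => j; apply: is_deriveM; first exact: is_derive_coord.
exact: (derivableP (gd j)).
Qed.

Lemma polyfun_derivable d f i x : polyfun d f -> derivable f x (evec R i).
Proof.
elim: d f => [|d IHd] f; first by move=> [c _ <-]; exact: derivable_cst.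
move=> [g0 [g [/IHd g0d Pg ->]]].
by have [] := is_derive_coord_expansion g0d (fun j => IHd _ (Pg j)).
Qed.

Lemma partial_coord_expansion d (g0 : 'rV[R]_n -> R)
    (g : 'I_n -> 'rV[R]_n -> R) i :
  polyfun d g0 -> (forall j, polyfun d (g j)) ->
  partial i (g0 + \sum_j coord j * g j) =
    partial i g0 + (g i + \sum_j coord j * partial i (g j)).
Proof.
move=> P0 Pg; apply/funext => x.
have [_ dE] := @is_derive_coord_expansion g0 g i x (polyfun_derivable P0)
  (fun j => polyfun_derivable (Pg j)).
by rewrite [LHS]dE -[RHS]/(_ + (_ + _)) fct_sumE.
Qed.

Lemma polyfun_partial d f i : polyfun d.+1 f -> polyfun d (partial i f).
Proof.
elim: d f => [|d IHd] _ [g0 [g [P0 Pg ->]]].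
  rewrite (@partial_coord_expansion 0)//.
  have partial_cst f : polyfun 0 f -> partial i f = 0.
    by move=> [c _ <-]; apply/funext => x; exact: derive_cst.
  rewrite (partial_cst _ P0) add0r big1 => [|j _].
    by rewrite addr0; exact: Pg.
  by rewrite (partial_cst _ (Pg j)) mulr0.
rewrite (@partial_coord_expansion d.+1)//.
apply: polyfunD; first by apply: polyfunS; exact: IHd.
apply: polyfunD; first exact: Pg.
apply: polyfun_sum => j; apply: (@polyfunM 1 d); first exact: polyfun_coord.
exact: IHd (Pg j).
Qed.

Lemma polyfun_C2 d f (Omega : set 'rV[R]_n) : polyfun d f -> C2_on Omega f.
Proof.
move=> /polyfunS/polyfunS Pf x _; split; first exact: (polyfun_continuous Pf).
move=> i; have Pfi := polyfun_partial i Pf.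
split; first exact: (polyfun_derivable Pf).
split; first exact: (polyfun_continuous Pfi).
move=> j; have Pfij := polyfun_partial j Pfi.
by split; [exact: (polyfun_derivable Pfi)|exact: (polyfun_continuous Pfij)].
Qed.

Lemma polyfun_span d : exists (I : finType) (m : I -> 'rV[R]_n -> R),
  forall f, polyfun d f -> exists a : I -> R, f = \sum_k a k *: m k.
Proof.
elim: d => [|d [I [m IHd]]].
  exists unit, (fun=> cst 1) => f [c _ <-]; exists (fun=> c).
  rewrite (bigD1 tt)//= big1 ?addr0 => [|[]//].
  by apply/funext => x; rewrite -[RHS]/(c * 1) mulr1.
exists (I + 'I_n * I)%type,
  (fun k => match k with inl k => m k | inr (i, k) => coord i * m k end).
move=> f [g0 [g [/IHd[a ga] Pg ->]]].
have /choice[b gb] i := IHd _ (Pg i).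
exists (fun k => match k with inl k => a k | inr (i, k) => b i k end).
rewrite big_sumType/= ga; congr (_ + _).
under eq_bigr => i _ do rewrite gb mulr_sumr.
rewrite pair_big/=; apply: eq_bigr => -[i k] _ /=.
by rewrite -![b i k *: _]/(cst (b i k) * _) mulrCA.
Qed.

Lemma polyfun_line d f x y : polyfun d f ->
  exists p : {poly R}, forall t, f (x + t *: y) = p.[t].
Proof.
elim: d f => [|d IHd] f.
  by move=> [c _ <-]; exists c%:P => t; rewrite hornerC.
move=> [g0 [g [/IHd[p0 p0E] Pg ->]]].
have /choice[p pE] i := IHd _ (Pg i).
exists (p0 + \sum_i ((x ord0 i)%:P + y ord0 i *: 'X) * p i) => t.
rewrite hornerD horner_sum -p0E -[LHS]/(_ + _) fct_sumE; congr (_ + _).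
apply: eq_bigr => i _.
by rewrite !hornerE -pE -[LHS]/(_ * _) /coord !mxE [t * _]mulrC.
Qed.

Lemma poly_near0_eq0 (p : {poly R}) : (\forall t \near 0, p.[t] = 0) -> p = 0.
Proof.
move=> /nbhs_normP[e /= e0 p_eq0]; apply/eqP; apply: contraT => p0.
pose s := [seq e / k.+2%:R | k <- iota 0 (size p)].
suff : (size s < size p)%N by rewrite size_map size_iota ltnn.
apply: max_poly_roots => //.
  apply/allP => _ /mapP[k _ ->]; apply/rootP/p_eq0.
  rewrite /ball_/= sub0r normrN gtr0_norm ?divr_gt0//.
  by rewrite ltr_pdivrMr// ltr_pMr// ltr1n.
rewrite map_inj_uniq ?iota_uniq// => k l /(mulfI (lt0r_neq0 e0))/invr_inj/eqP.
by rewrite eqr_nat => /eqP[].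
Qed.

Lemma polyfun_near_eq0 d f z :
  polyfun d f -> (\forall x \near z, f x = 0) -> f = 0.
Proof.
move=> Pf f_eq0; apply/funext => x; have [p pE] := polyfun_line z (x - z) Pf.
have p0 : p = 0.
  apply: poly_near0_eq0.
  have : \forall t \near (0 : R), f (z + t *: (x - z)) = 0.
    exact: cvg_line f_eq0.
  by apply: filterS => t; rewrite -pE.
by have := pE 1; rewrite p0 horner0 scale1r addrC subrK.
Qed.

End PolynomialFunctions.

(** * Comparison for viscosity subsolutions *)

Section Comparison.
Context {R : realType} {n : nat}.
Variable Omega : set 'rV[R]_n.
Hypothesis Omega_open : open Omega.
Implicit Types (F G : 'M[R]_n -> R) (u f h : 'rV[R]_n -> R) (x z : 'rV[R]_n).

Lemma within_open_continuous u x : {within Omega, continuous u} -> Omega x ->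
  {for x, continuous u}.
Proof.
by rewrite continuous_open_subspace// => uc Ox; apply: uc; rewrite inE.
Qed.

Lemma C2_on_within_continuous f : C2_on Omega f -> {within Omega, continuous f}.
Proof. by move=> f_C2; apply: continuous_in_subspaceT => x /set_mem/f_C2[]. Qed.

Lemma visc_subsol_mono F G u : (forall M, symmx M -> 0 <= F M -> 0 <= G M) ->
  visc_subsol F Omega u -> visc_subsol G Omega u.
Proof.
move=> FG [uc u_sub]; split=> // phi x phi_C2 Ox touch.
by apply: FG; [exact: hessian_symmx phi_C2 _ Ox|exact: u_sub].
Qed.

Lemma C2_visc_subsol F f : degenerate_elliptic F -> C2_on Omega f ->
  (forall x, Omega x -> 0 <= F (hessian f x)) -> visc_subsol F Omega f.
Proof.
move=> Fell f_C2 Ff; split; first exact: C2_on_within_continuous.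
move=> phi x phi_C2 Ox touch.
have fs := hessian_symmx Omega_open f_C2 Ox.
have phis := hessian_symmx Omega_open phi_C2 Ox.
apply: le_trans (Ff _ Ox) (degenerate_elliptic_le Fell fs phis _).
have fphiE y : (-1 *: phi + f) y = f y - phi y.
  by rewrite -[LHS]/(-1 * phi y + f y) mulN1r addrC.
have fphi_C2 := C2_on_linear (-1) Omega_open phi_C2 f_C2.
have := local_max_hessian_psd fphi_C2 Omega_open Ox.
rewrite (hessian_linear _ Omega_open phi_C2 f_C2 Ox).
rewrite [-1 *: hessian phi x]scaleN1r opprD opprK.
by apply; apply: filterS touch => y; rewrite !fphiE.
Qed.

Lemma visc_subsol_comparison F u h z r m : visc_subsol F Omega u ->
  C2_on Omega h -> closed_eball z r `<=` Omega ->
  (forall x, eball z r x -> F (hessian h x) < 0) ->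
  (forall x, esphere z r x -> u x - h x <= m) ->
  forall x, closed_eball z r x -> u x - h x <= m.
Proof.
move=> [uc u_sub] h_C2 ballO Fh uh_le x xr.
have ball_neq0 : closed_eball z r !=set0 by exists x.
have uhc : {within closed_eball z r, continuous (u - h)}.
  apply: continuous_in_subspaceT => y /set_mem/ballO Oy; apply: continuousB.
    exact: within_open_continuous.
  exact: C2_on_continuous h_C2 _ Oy.
have [p] := EVT_max_rV ball_neq0 (@compact_closed_eball R n z r) uhc.
rewrite inE => pr pmax; apply: le_trans (pmax x _) _; first by rewrite inE.
have [pr'|/uh_le//] := closed_eball_split pr.
have := Fh p pr'; rewrite ltNge u_sub//; first exact: ballO.
apply: filterS (near_eball pr') => y yr.
by apply: pmax; rewrite inE; exact: sub_eball_closed_eball.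
Qed.

(* Otherwise comparison would hold with every polynomial: take a steep enough
   paraboloid with vertex below [u z]. *)
Lemma visc_subsol_superlevel_neq0 F u z : visc_subsol F Omega u -> Omega z ->
  exists2 M, symmx M & 0 <= F M.
Proof.
move=> u_sub Oz; apply: contrapT => no_superlevel.
have F_lt0 M : symmx M -> F M < 0.
  by move=> Ms; rewrite ltNge; apply/negP => FM; apply: no_superlevel; exists M.
have [r r0 ballO] := nbhs_closed_eball (near_open Omega_open Oz).
have zr := closed_eball_center z r.
have ball_neq0 : closed_eball z r !=set0 by exists z.
have uc : {within closed_eball z r, continuous u}.
  exact: continuous_subspaceW ballO u_sub.1.
have [p _ pmax] := EVT_max_rV ball_neq0 (@compact_closed_eball R n z r) uc.
pose a := (u p - (u z - 1)) / r ^+ 2; pose h := a *: sqdist z.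
have hE x : h x = a * sqdist z x by [].
have h_C2 : C2_on Omega h := polyfun_C2 (polyfunZ a (polyfun_sqdist z)).
suff : u z - h z <= u z - 1.
  by rewrite hE sqdistxx mulr0 subr0 lerBrDr gerDl ler10.
apply: (visc_subsol_comparison u_sub h_C2 ballO) zr => [x xr|x xr].
  apply: F_lt0; apply: (hessian_symmx Omega_open h_C2).
  exact/ballO/sub_eball_closed_eball.
rewrite hE [sqdist z x]xr divfK; last by rewrite gt_eqF// exprn_gt0.
rewrite opprB addrCA gerDl subr_le0.
by apply: pmax; rewrite inE; exact: sub_esphere_closed_eball.
Qed.

End Comparison.

(** * The Dirichlet problem for polynomials *)

Section TraceOfTheHessian.
Context {R : realType} {n : nat}.
Variable A : 'M[R]_n.
Implicit Types (f g : 'rV[R]_n -> R) (x z : 'rV[R]_n) (Omega : set 'rV[R]_n).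

Definition tr_hessian f x : R := \tr (A *m hessian f x).

Lemma tr_hessianE f x :
  tr_hessian f x = \sum_i \sum_k A i k * partial i (partial k f) x.
Proof.
by apply: eq_bigr => i _; rewrite mxE; apply: eq_bigr => k _; rewrite mxE.
Qed.

Lemma affine_op_hessian c f x :
  affine_op A c (hessian f x) = tr_hessian f x - c.
Proof. by []. Qed.

Lemma tr_hessian_linear Omega (a : R) f g x : open Omega ->
  C2_on Omega f -> C2_on Omega g -> Omega x ->
  tr_hessian (a *: f + g) x = a * tr_hessian f x + tr_hessian g x.
Proof.
move=> Omega_open f_C2 g_C2 Ox; rewrite /tr_hessian.
rewrite (hessian_linear _ Omega_open f_C2 g_C2 Ox).
by rewrite mulmxDr mxtraceD -scalemxAr mxtraceZ.
Qed.

Lemma tr_hessian_polyfun_linear d e (a : R) f g x :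
  polyfun d f -> polyfun e g ->
  tr_hessian (a *: f + g) x = a * tr_hessian f x + tr_hessian g x.
Proof.
move=> Pf Pg; apply: (tr_hessian_linear _ openT) => //.
  exact: polyfun_C2 Pf.
exact: polyfun_C2 Pg.
Qed.

Lemma tr_hessian_cst c x : tr_hessian (cst c) x = 0.
Proof.
rewrite tr_hessianE big1// => i _; rewrite big1// => k _.
have -> : partial k (cst c) = cst 0 by apply/funext => y; exact: derive_cst.
by rewrite [partial i _ x]derive_cst mulr0.
Qed.

Lemma tr_hessian_polyfunZ d (a : R) f x : polyfun d f ->
  tr_hessian (a *: f) x = a * tr_hessian f x.
Proof.
move=> Pf; have P0 := @polyfun_cst R n 0 0.
rewrite -[a *: f]addr0 (tr_hessian_polyfun_linear _ _ Pf P0).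
by rewrite tr_hessian_cst addr0.
Qed.

Lemma tr_hessian_continuous Omega f x : C2_on Omega f -> Omega x ->
  {for x, continuous (tr_hessian f)}.
Proof.
move=> f_C2 Ox; rewrite (funext (tr_hessianE f)).
apply: continuous_at_sum => i; apply: continuous_at_sum => k.
apply: (@continuousM _ _ (cst (A i k))); first exact: cst_continuous.
by have [_ /(_ k)[_ [_ /(_ i)[]]]] := f_C2 _ Ox.
Qed.

Lemma polyfun_tr_hessian d f : polyfun d.+2 f -> polyfun d (tr_hessian f).
Proof.
move=> Pf.
have -> : tr_hessian f = \sum_i \sum_k A i k *: partial i (partial k f).
  apply/funext => x; rewrite tr_hessianE fct_sumE.
  by apply: eq_bigr => i _; rewrite fct_sumE.
apply: polyfun_sum => i; apply: polyfun_sum => k; apply: polyfunZ.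
by apply: polyfun_partial; exact: polyfun_partial.
Qed.

Lemma partial_sqdist z i :
  partial i (sqdist z) = 2 *: coord i + cst (- (2 * z ord0 i)).
Proof.
apply/funext => x; rewrite sqdistE.
have sum_derive : is_derive x (evec R i)
    (\sum_j (coord j - cst (z ord0 j)) ^+ 2)
    (\sum_j (2 * (x ord0 j - z ord0 j) * ((j == i)%:R - 0))).
  apply: is_derive_sum => j; have dj := @is_derive_coord R n x j i.
  apply: is_derive_eq; rewrite -[_ *: _]/(_ * _) expr1 mulr_natl.
  by rewrite [LHS]/(_ * _).
have [_ dE] := sum_derive.
rewrite [LHS]dE (bigD1 i)//= eqxx big1 => [|j /negbTE ->].
  by rewrite addr0 subr0 mulr1 mulrBr.
by rewrite subrr mulr0.
Qed.

Lemma hessian_sqdist z x : hessian (sqdist z) x = 2%:M.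
Proof.
apply/matrixP => i j; rewrite !mxE partial_sqdist.
have coord_derive : is_derive x (evec R j)
    (2 *: coord i + cst (- (2 * z ord0 i))) (2 *: (i == j)%:R + 0).
  by have dj := @is_derive_coord R n x i j; apply: is_deriveD.
have [_ dE] := coord_derive.
by rewrite [LHS]dE addr0 -[LHS]/(2 * (i == j)%:R) mulr_natr.
Qed.

Lemma tr_hessian_sqdist z x : tr_hessian (sqdist z) x = 2 * \tr A.
Proof. by rewrite /tr_hessian hessian_sqdist mul_mx_scalar mxtraceZ. Qed.

End TraceOfTheHessian.

Section PolynomialDirichletProblem.
Context {R : realType} {n : nat}.
Variable A : 'M[R]_n.
Hypotheses (A_symm : symmx A) (A_psd : psd A) (A_neq0 : A != 0).
Implicit Types (p q g u : 'rV[R]_n -> R) (x z : 'rV[R]_n) (r : R).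

Let trA_gt0 : 0 < \tr A := psd_mxtrace_gt0 A_symm A_psd A_neq0.

Lemma visc_subsol_max_principle Omega u z r (c m : R) : open Omega ->
  visc_subsol (affine_op A c) Omega u -> 0 <= c -> 0 < r ->
  closed_eball z r `<=` Omega -> (forall x, esphere z r x -> u x <= m) ->
  forall x, closed_eball z r x -> u x <= m.
Proof.
move=> Omega_open u_sub c0 r0 ballO u_le x xr; apply/ler_addgt0Pr => e e0.
have r2_gt0 : 0 < r ^+ 2 by rewrite exprn_gt0.
have Psq := polyfun_sqdist z.
pose h := - (e / r ^+ 2) *: sqdist z.
have hE y : - h y = e / r ^+ 2 * sqdist z y.
  by rewrite -[h y]/(- _ * _) mulNr opprK.
apply: (@le_trans _ _ (u x - h x)).
  by rewrite hE lerDl mulr_ge0 ?sqdist_ge0 ?divr_ge0 ?ltW.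
have h_C2 : C2_on Omega h := polyfun_C2 (polyfunZ _ Psq).
apply: (visc_subsol_comparison Omega_open u_sub h_C2 ballO) xr => y yr.
  rewrite affine_op_hessian (tr_hessian_polyfunZ _ _ _ Psq) tr_hessian_sqdist.
  by rewrite subr_lt0 (lt_le_trans _ c0)// mulNr oppr_lt0 !mulr_gt0 ?invr_gt0.
by rewrite hE [sqdist z y]yr divfK ?gt_eqF// lerD2r u_le.
Qed.

Lemma tr_hessian_eq_visc_subsol Omega h k : open Omega -> C2_on Omega h ->
  (forall x, Omega x -> tr_hessian A h x = k) ->
  visc_subsol (affine_op A k) Omega h.
Proof.
move=> Omega_open h_C2 hk; apply: C2_visc_subsol => //.
  exact: degenerate_elliptic_affine_op.
by move=> x /hk hxk; rewrite affine_op_hessian hxk subrr.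
Qed.

Lemma harmonic_polyfun_le0 d q z r : 0 < r -> polyfun d q ->
  (forall x, tr_hessian A q x = 0) -> (forall x, esphere z r x -> q x = 0) ->
  forall x, closed_eball z r x -> q x <= 0.
Proof.
move=> r0 Pq q_harm q0.
apply: (visc_subsol_max_principle openT _ (lexx 0)) => // [|x /q0 -> //].
by apply: tr_hessian_eq_visc_subsol => //; [exact: openT|exact: polyfun_C2 Pq].
Qed.

Lemma harmonic_polyfun_eq0 d q z r : 0 < r -> polyfun d q ->
  (forall x, tr_hessian A q x = 0) -> (forall x, esphere z r x -> q x = 0) ->
  q = 0.
Proof.
move=> r0 Pq q_harm q0.
have NqE x : (-1 *: q) x = - q x by exact: mulN1r.
apply: (polyfun_near_eq0 (z := z) Pq).
apply: filterS (near_eball (eball_center z r0)) => x /sub_eball_closed_eball xr.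
apply/le_anti/andP; split.
  exact: harmonic_polyfun_le0 r0 Pq q_harm q0 x xr.
rewrite -oppr_le0 -NqE.
apply: harmonic_polyfun_le0 r0 (polyfunZ (-1) Pq) _ _ x xr => y.
  by rewrite (tr_hessian_polyfunZ _ _ _ Pq) q_harm mulr0.
by move=> /q0 qy; rewrite NqE qy oppr0.
Qed.

Definition bump z r : 'rV[R]_n -> R := -1 *: sqdist z + cst (r ^+ 2).

Lemma bumpE z r x : bump z r x = r ^+ 2 - sqdist z x.
Proof. by rewrite -[LHS]/(-1 * sqdist z x + r ^+ 2) mulN1r addrC. Qed.

Lemma bumpM_esphere z r p x : esphere z r x -> (bump z r * p) x = 0.
Proof.
move=> xr; rewrite -[LHS]/(bump z r x * p x) bumpE [sqdist z x]xr.
by rewrite subrr mul0r.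
Qed.

Lemma polyfun_bumpM d z r p : polyfun d p -> polyfun d.+2 (bump z r * p).
Proof.
apply: (@polyfunM _ _ 2); apply: polyfun_linear; last exact: polyfun_cst.
exact: polyfun_sqdist.
Qed.

Lemma tr_hessian_bumpM_linear d z r (a : R) p q : polyfun d p -> polyfun d q ->
  tr_hessian A (bump z r * (a *: p + q)) =
  a *: tr_hessian A (bump z r * p) + tr_hessian A (bump z r * q).
Proof.
move=> Pp Pq; apply/funext => x.
have PbMp := polyfun_bumpM z r Pp; have PbMq := polyfun_bumpM z r Pq.
apply: etrans (tr_hessian_polyfun_linear _ a x PbMp PbMq).
by congr (tr_hessian A _ x); rewrite mulrDr -[a *: p]/(cst a * p) mulrCA.
Qed.

Lemma tr_hessian_bumpM_inj d z r p : 0 < r -> polyfun d p ->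
  tr_hessian A (bump z r * p) = 0 -> p = 0.
Proof.
move=> r0 Pp bump_harm.
have bump0 : bump z r * p = 0.
  apply: (harmonic_polyfun_eq0 r0 (polyfun_bumpM z r Pp)).
    by move=> x; rewrite bump_harm.
  exact: bumpM_esphere.
apply: (polyfun_near_eq0 (z := z) Pp).
apply: filterS (near_eball (eball_center z r0)) => x xr.
have /eqP := congr1 (fun q => q x) bump0.
by rewrite mulf_eq0 bumpE subr_eq0 gt_eqF// => /eqP.
Qed.

(* This map does not raise the degree, so that it is an injective endomorphism
   of a finite dimensional space. *)
Lemma tr_hessian_bumpM_surj d z r q : 0 < r -> polyfun d q ->
  exists2 p, polyfun d p & tr_hessian A (bump z r * p) = q.
Proof.
move=> r0; have [I [m span]] := @polyfun_span R n d.
apply: fin_span_inj_surj span q; first exact: polyfun_cst.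
- by move=> a p q; exact: polyfun_linear.
- by move=> p /(polyfun_bumpM z r); exact: polyfun_tr_hessian.
- by move=> a p q; exact: tr_hessian_bumpM_linear.
- by move=> p; exact: tr_hessian_bumpM_inj.
Qed.

Lemma polynomial_dirichlet d g z r (k : R) : 0 < r -> polyfun d g ->
  exists h, [/\ polyfun d.+2 h, forall x, tr_hessian A h x = k &
    forall x, esphere z r x -> h x = g x].
Proof.
move=> r0 Pg; have Pg2 := polyfunS (polyfunS Pg).
have [|p Pp pE] :=
    @tr_hessian_bumpM_surj d z r (-1 *: tr_hessian A g + cst k) r0.
  by apply: polyfun_linear; [exact: polyfun_tr_hessian|exact: polyfun_cst].
have Pbp := polyfun_bumpM z r Pp.
exists (1 *: (bump z r * p) + g); split; first exact: polyfun_linear.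
- move=> x; rewrite (tr_hessian_polyfun_linear _ _ _ Pbp Pg) mul1r pE.
  by rewrite -[X in X + _]/(-1 * _ + k) mulN1r addrAC addNr add0r.
- move=> x /(bumpM_esphere p) bp0.
  by rewrite -[LHS]/(1 * (bump z r * p) x + g x) bp0 mulr0 add0r.
Qed.

End PolynomialDirichletProblem.

(** * Uniform approximation by polynomials *)

Section RandomWalk.
Context {R : realType} {n : nat} {I : finType}.
Variables (wt : I -> 'rV[R]_n -> R) (step : I -> 'rV[R]_n) (h : R).
Implicit Types (f g : 'rV[R]_n -> R) (s x w : 'rV[R]_n) (k : nat).

(* [walk k f s x] is the expectation of [f] after [k] steps from [s], the step
   [h *: step o] being taken with probability [wt o x]: a Bernstein polynomial
   in [x] when the weights are affine. *)
Fixpoint walk k f s : 'rV[R]_n -> R :=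
  if k is k'.+1 then \sum_o wt o * walk k' f (s + h *: step o) else cst (f s).

Lemma walkS k f s x :
  walk k.+1 f s x = \sum_o wt o x * walk k f (s + h *: step o) x.
Proof. by rewrite /= fct_sumE. Qed.

Lemma polyfun_walk k f s :
  (forall o, polyfun 1 (wt o)) -> polyfun k (walk k f s).
Proof.
move=> Pwt; elim: k s => [|k IHk] s; first exact: polyfun_cst.
by apply: polyfun_sum => o; exact: (polyfunM (Pwt o) (IHk _)).
Qed.

Variable x : 'rV[R]_n.
Hypotheses (wt_ge0 : forall o, 0 <= wt o x) (sum_wt : \sum_o wt o x = 1).

Lemma le_walk k f g s : (forall y, f y <= g y) -> walk k f s x <= walk k g s x.
Proof.
move=> fg; elim: k s => [|k IHk] s; first exact: fg.
by rewrite !walkS; apply: ler_sum => o _; exact: ler_wpM2l.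
Qed.

Lemma walk_affine k (a b : R) f s :
  walk k (fun y => a + b * f y) s x = a + b * walk k f s x.
Proof.
elim: k s => [//|k IHk] s; rewrite !walkS.
under eq_bigr => o _ do rewrite IHk mulrDr mulrCA.
by rewrite big_split/= -mulr_suml sum_wt mul1r -mulr_sumr.
Qed.

(* Bias-variance decomposition: the walk drifts by [h *: w] at each step, and
   the variances of the steps add up. *)
Lemma walk_sqdist_le k s w (V : R) :
  (forall i, \sum_o wt o x * step o ord0 i = w ord0 i) ->
  (forall o, sqnorm (step o) <= V) ->
  walk k (sqdist x) s x <= sqnorm (s - x + (k%:R * h) *: w) + k%:R * h ^+ 2 * V.
Proof.
move=> mean_step stepV; elim: k s => [|k IHk] s.
  by rewrite !mul0r scale0r !addr0.
rewrite walkS; pose t := s - x + (k%:R * h) *: w.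
have mean_dotrv : \sum_o wt o x * dotrv t (step o) = dotrv t w.
  rewrite /dotrv; under eq_bigr => o _ do rewrite mulr_sumr.
  rewrite exchange_big; apply: eq_bigr => i _ /=; rewrite -mean_step mulr_sumr.
  by apply: eq_bigr => o _; rewrite mulrCA.
have tSE : s - x + (k.+1%:R * h) *: w = t + h *: w.
  by rewrite /t -[RHS]addrA -scalerDl -[k.+1]addn1 natrD mulrDl mul1r.
have stepE o : s + h *: step o - x + (k%:R * h) *: w = t + h *: step o.
  by rewrite /t [s + _ - x]addrAC [RHS]addrAC.
pose a := sqnorm t + h ^+ 2 * V + k%:R * h ^+ 2 * V.
apply: (@le_trans _ _ (\sum_o wt o x * (a + 2 * h * dotrv t (step o)))).
  apply: ler_sum => o _; apply: ler_wpM2l => //; apply: le_trans (IHk _) _.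
  rewrite stepE sqnormD /a; have := ler_wpM2l (sqr_ge0 h) (stepV o).
  by move: (sqnorm t) (dotrv t _) (sqnorm _) => t1 t2 t3; lra.
under eq_bigr => o _ do rewrite mulrDr mulrCA.
rewrite big_split/= -mulr_suml sum_wt mul1r -mulr_sumr mean_dotrv tSE sqnormD.
have := mulr_ge0 (sqr_ge0 h) (sqnorm_ge0 w); rewrite /a -[k.+1]addn1 natrD.
by move: (sqnorm t) (dotrv t w) (sqnorm w) => t1 t2 t3; lra.
Qed.

End RandomWalk.

Section CoordinateWalk.
Context {R : realType} {n : nat}.
Variables (z : 'rV[R]_n) (r : R).
Implicit Types (o : 'I_n * bool) (x : 'rV[R]_n) (i : 'I_n).

Let sign (b : bool) : R := if b then 1 else -1.

Definition coord_wt o : 'rV[R]_n -> R :=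
  (sign o.2 / r / (2 * n%:R)) *: coord o.1 +
  cst ((1 - sign o.2 * z ord0 o.1 / r) / (2 * n%:R)).

Definition coord_step o : 'rV[R]_n := (sign o.2 * n%:R * r) *: evec R o.1.

Lemma coord_wtE o x : coord_wt o x =
  (1 + sign o.2 * ((x - z) ord0 o.1 / r)) / (2 * n%:R).
Proof.
rewrite -[LHS]/(sign o.2 / r / (2 * n%:R) * x ord0 o.1 +
  (1 - sign o.2 * z ord0 o.1 / r) / (2 * n%:R)) !mxE.
by ring.
Qed.

Lemma polyfun_coord_wt o : polyfun 1 (coord_wt o).
Proof. by apply: polyfun_linear; [exact: polyfun_coord|exact: polyfun_cst]. Qed.

Lemma sqnorm_coord_step o : sqnorm (coord_step o) = (n%:R * r) ^+ 2.
Proof.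
rewrite /sqnorm (bigD1 o.1)//= big1 => [|j /negbTE ji]; last first.
  by rewrite !mxE ji/= mulr0 expr0n.
rewrite !mxE !eqxx mulr1 addr0 /sign.
by case: o.2; rewrite ?mulN1r ?mul1r ?mulNr ?sqrrN.
Qed.

Hypotheses (n_gt0 : (0 < n)%N) (r_gt0 : 0 < r).

Let n_neq0 : n%:R != 0 :> R.
Proof. by rewrite pnatr_eq0 -lt0n. Qed.

Let r_neq0 : r != 0.
Proof. by rewrite gt_eqF. Qed.

Lemma coord_wt_ge0 o x : closed_eball z r x -> 0 <= coord_wt o x.
Proof.
move=> /(closed_eball_norm (ltW r_gt0)) xr; rewrite coord_wtE.
rewrite divr_ge0 ?mulr_ge0 ?ler0n//.
have : `|(x - z) ord0 o.1 / r| <= 1.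
  rewrite normrM normfV (gtr0_norm r_gt0) ler_pdivrMr// mul1r.
  exact: le_trans (coord_le_norm _ _) xr.
rewrite ler_norml /sign; move: (_ / r) => t /andP[t1 t2].
by case: o.2; lra.
Qed.

Lemma sum_coord_wt x : \sum_o coord_wt o x = 1.
Proof.
rewrite -(pair_bigA _ (fun i b => coord_wt (i, b) x))/=.
under eq_bigr => i _ do rewrite big_bool !coord_wtE.
transitivity (\sum_(i < n) (n%:R^-1 : R)).
  by apply: eq_bigr => i _; rewrite /sign/=; field; rewrite n_neq0.
by rewrite sumr_const card_ord -[LHS]mulr_natr mulVf.
Qed.

Lemma mean_coord_step x i :
  \sum_o coord_wt o x * coord_step o ord0 i = (x - z) ord0 i.
Proof.
rewrite -(pair_bigA _
  (fun j b => coord_wt (j, b) x * coord_step (j, b) ord0 i))/=.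
under eq_bigr => j _ do rewrite big_bool.
rewrite (bigD1 i)//= big1 => [|j /negbTE ji]; last first.
  by rewrite !mxE [i == j]eq_sym ji/= !mulr0 addr0.
rewrite !coord_wtE; move: ((x - z) ord0 i) => t.
by rewrite !mxE !eqxx /sign/=; field; rewrite r_neq0 n_neq0.
Qed.

Definition bernstein N f : 'rV[R]_n -> R :=
  walk coord_wt coord_step N.+1%:R^-1 N.+1 f z.

Lemma polyfun_bernstein N f : polyfun N.+1 (bernstein N f).
Proof. by apply: polyfun_walk => o; exact: polyfun_coord_wt. Qed.

Lemma bernstein_sqdist_le N x : closed_eball z r x ->
  bernstein N (sqdist x) x <= (n%:R * r) ^+ 2 / N.+1%:R.
Proof.
move=> xr; have wt_ge0 o := coord_wt_ge0 o xr.
have stepV o : sqnorm (coord_step o) <= (n%:R * r) ^+ 2.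
  by rewrite sqnorm_coord_step.
have := walk_sqdist_le N.+1%:R^-1 wt_ge0 (sum_coord_wt x) N.+1 z
  (mean_coord_step x) stepV.
rewrite divff// scale1r addrA subrK subrr sqnorm0 add0r.
by rewrite expr2 mulrA divff// mul1r mulrC.
Qed.

Lemma bernstein_approx N f x (e C : R) : 0 <= C ->
  C * (n%:R * r) ^+ 2 / N.+1%:R <= e -> closed_eball z r x ->
  (forall y, `|f y - f x| <= e + C * sqdist x y) ->
  `|bernstein N f x - f x| <= 2 * e.
Proof.
move=> C0 Ce xr f_modulus; have wt_ge0 o := coord_wt_ge0 o xr.
have C_sqdist : C * bernstein N (sqdist x) x <= e.
  by apply: le_trans Ce; rewrite -mulrA ler_wpM2l// bernstein_sqdist_le.
have affineE a b : bernstein N (fun y => a + b * sqdist x y) x =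
    a + b * bernstein N (sqdist x) x.
  by apply: walk_affine; exact: sum_coord_wt.
have upper : bernstein N f x <= (f x + e) + C * bernstein N (sqdist x) x.
  rewrite -affineE; apply: le_walk => // y.
  by have := f_modulus y; rewrite ler_norml => /andP[_]; lra.
have lower : (f x - e) + (- C) * bernstein N (sqdist x) x <= bernstein N f x.
  rewrite -affineE; apply: le_walk => // y.
  by have := f_modulus y; rewrite ler_norml => /andP[+ _]; lra.
by rewrite ler_norml; apply/andP; split; lra.
Qed.

End CoordinateWalk.

Section Density.
Context {R : realType} {n : nat}.
Implicit Types (f g u : 'rV[R]_n -> R) (x y z : 'rV[R]_n) (K : set 'rV[R]_n).

Lemma compact_unif_continuous_at g K (e : R) :
  compact K -> continuous g -> 0 < e ->
  exists2 d, 0 < d & forall x y, K x -> `|y - x| < d -> `|g y - g x| <= e.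
Proof.
move=> /compact_near_coveringP K_cover gc e0.
pose P (d : R) x := forall y, `|y - x| < d -> `|g y - g x| <= e.
have : \forall d \near (0 : R)^'+, K `<=` P d.
  apply: K_cover => x Kx.
  have : \forall y \near x, `|g x - g y| <= e / 2.
    by move: (gc x) => /cvgrPdist_le; apply; rewrite divr_gt0.
  move=> /nbhs_normP[d /= d0 gd].
  exists (ball x (d / 2), [set t | t < d / 2]).
    split=> /=; last by apply: nbhs_right_lt; rewrite divr_gt0.
    by apply: nbhsx_ballx; rewrite divr_gt0.
  move=> [x' t] [/= xx' td] y yx'.
  rewrite -ball_normE/= in xx'.
  rewrite (le_trans (ler_distD (g x) _ _))// [leRHS]splitr lerD//.
    rewrite distrC; apply: gd; rewrite /ball_/=.
    rewrite (le_lt_trans (ler_distD x' _ _))//.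
    by rewrite [ltRHS]splitr ltrD// distrC (lt_trans yx').
  by apply: gd; rewrite /ball_/= (lt_trans xx')// ltr_pdivrMr// ltr_pMr// ltr1n.
move=> near_P; have [d [d0 dP]] : exists d : R, 0 < d /\ K `<=` P d.
  near (0 : R)^'+ => d; exists d; split; first by [].
  by near: d.
by exists d => // x y Kx; exact: dP.
Unshelve. all: end_near. Qed.

Lemma compact_quadratic_modulus g K (M e : R) : compact K -> continuous g ->
  (forall x, `|g x| <= M) -> 0 < e ->
  exists2 C, 0 <= C & forall x y, K x -> `|g y - g x| <= e + C * sqdist x y.
Proof.
move=> Kc gc gM e0; have [d d0 gd] := compact_unif_continuous_at Kc gc e0.
have M0 : 0 <= M := le_trans (normr_ge0 _) (gM 0).
have C0 : 0 <= 2 * M / d ^+ 2.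
  by apply: divr_ge0; [exact: mulr_ge0|exact: sqr_ge0].
exists (2 * M / d ^+ 2) => // x y Kx; have [yd|yd] := ltP `|y - x| d.
  by rewrite (le_trans (gd x y Kx yd))// lerDl mulr_ge0// sqdist_ge0.
have dS : d ^+ 2 <= sqdist x y.
  by apply: le_trans (norm_le_sqnorm _); rewrite lerXn2r ?nnegrE// ltW.
apply: (@le_trans _ _ (2 * M)).
  by rewrite (le_trans (ler_normB _ _))// mulr_natl mulr2n lerD.
apply: (@le_trans _ _ (2 * M / d ^+ 2 * sqdist x y)).
  by rewrite mulrAC ler_pdivlMr ?exprn_gt0// ler_wpM2l// mulr_ge0.
by rewrite lerDr ltW.
Qed.

Lemma continuous_polyfun_approx u z r (e : R) : 0 < r -> 0 < e ->
  {within closed_eball z r, continuous u} ->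
  exists d p, polyfun d p /\ forall x, closed_eball z r x -> `|p x - u x| <= e.
Proof.
move=> r0 e0 uc; have [n0|n0] := posnP n.
  exists 0%N, (cst (u z)); split=> [|x _]; first exact: polyfun_cst.
  suff -> : x = z by rewrite subrr normr0 ltW.
  by apply/rowP => i; have := ltn_ord i; rewrite [X in (_ < X)%N]n0.
have Kc : compact (closed_eball z r) := @compact_closed_eball R n z r.
have [M M0 uM] : exists2 M, 0 < M & forall x, closed_eball z r x -> `|u x| <= M.
  have [M [_ Mu]] := compact_bounded (continuous_compact uc Kc).
  exists (`|M| + 1) => [|x xr]; first by rewrite ltr_wpDl.
  apply: (Mu (`|M| + 1)); last by exists x.
  by rewrite (le_lt_trans (ler_norm _))// ltrDl.
have [||g [ug gc gM]] := continuous_bounded_extension _ _ M0 uc uM.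
- exact: pseudometric_normal.
- exact: closed_closed_eball.
have e2 : 0 < e / 2 by rewrite divr_gt0.
have [C C0 g_modulus] := compact_quadratic_modulus Kc gc gM e2.
pose N := Num.truncn (C * (n%:R * r) ^+ 2 / (e / 2)).
have CN : C * (n%:R * r) ^+ 2 / N.+1%:R <= e / 2.
  by rewrite ler_pdivrMr// [leRHS]mulrC -ler_pdivrMr//; exact/ltW/truncnS_gt.
exists N.+1, (bernstein z r N g).
split=> [|x xr]; first exact: polyfun_bernstein.
rewrite (ug x); last by rewrite inE.
have := bernstein_approx n0 r0 C0 CN xr (fun y => g_modulus x y xr).
by rewrite mulrC divfK.
Qed.

End Density.

(** * Convex combinations of viscosity subsolutions *)

Section LinearEquation.
Context {R : realType} {n : nat}.
Variables (A : 'M[R]_n) (Omega : set 'rV[R]_n).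
Hypotheses (A_symm : symmx A) (A_psd : psd A) (A_neq0 : A != 0).
Hypothesis Omega_open : open Omega.
Implicit Types (u v w h phi : 'rV[R]_n -> R) (x z : 'rV[R]_n).
Implicit Types (c k r e theta : R).

Let trA_gt0 : 0 < \tr A := psd_mxtrace_gt0 A_symm A_psd A_neq0.

Definition has_harmonic_majorants c w : Prop :=
  forall k z r e, k < c -> 0 < r -> 0 < e -> closed_eball z r `<=` Omega ->
  exists h, [/\ C2_on Omega h, forall x, Omega x -> tr_hessian A h x = k,
    forall x, closed_eball z r x -> w x <= h x &
    forall x, esphere z r x -> h x <= w x + e].

Lemma visc_subsol_harmonic_majorants c u :
  visc_subsol (affine_op A c) Omega u -> has_harmonic_majorants c u.
Proof.
move=> u_sub k z r e kc r0 e0 ballO.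
have uc : {within closed_eball z r, continuous u}.
  exact: continuous_subspaceW ballO u_sub.1.
have e2 : 0 < e / 2 by rewrite divr_gt0.
have [d [p [Pp pu]]] := continuous_polyfun_approx r0 e2 uc.
have [h [Ph hk hp]] := polynomial_dirichlet A_symm A_psd A_neq0 z k r0
  (polyfunD Pp (polyfun_cst d (e / 2))).
have h_C2 : C2_on Omega h := polyfun_C2 Ph.
have near_sphere x : esphere z r x -> u x <= h x <= u x + e.
  move=> xr; have := pu x (sub_esphere_closed_eball xr).
  by rewrite (hp x xr) -[(p + _) x]/(p x + e / 2) ler_norml; lra.
exists h; split=> // x xr; last by have /andP[] := near_sphere x xr.
rewrite -subr_le0.
apply: (visc_subsol_comparison Omega_open u_sub h_C2 ballO) xr => y yr.
  by rewrite affine_op_hessian hk subr_lt0.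
by rewrite subr_le0; have /andP[] := near_sphere y yr.
Qed.

Lemma tr_hessian_perturb_lt c phi z : C2_on Omega phi -> Omega z ->
  tr_hessian A phi z < c ->
  exists2 eta, 0 < eta & tr_hessian A (eta *: sqdist z + phi) z < c.
Proof.
move=> phi_C2 Oz phi_lt_c.
exists ((c - tr_hessian A phi z) / (4 * \tr A)).
  by rewrite divr_gt0 ?subr_gt0 ?mulr_gt0.
have sqdist_C2 : C2_on Omega (sqdist z) := polyfun_C2 (polyfun_sqdist z).
rewrite (tr_hessian_linear _ _ Omega_open sqdist_C2 phi_C2 Oz).
rewrite tr_hessian_sqdist; move: (tr_hessian A phi z) phi_lt_c => t tc.
have -> : (c - t) / (4 * \tr A) * (2 * \tr A) = (c - t) / 2.
  by field; rewrite gt_eqF.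
by lra.
Qed.

(* Perturb [phi] to the strict supersolution [psi := phi + eta |x - z|^2]: on a
   small sphere [psi] exceeds the touching function by [eta r ^+ 2], so that
   comparing [psi] with a majorant of [w] at [z] gives a contradiction. *)
Lemma harmonic_majorants_touch c w phi z : has_harmonic_majorants c w ->
  C2_on Omega phi -> Omega z ->
  (\forall x \near z, w x - phi x <= w z - phi z) -> c <= tr_hessian A phi z.
Proof.
have on_sphere (wx hx px wz pz a : R) : hx <= wx + a / 2 ->
    wx - px <= wz - pz -> hx - (a + px) <= wz - pz - a / 2 by lra.
have at_center (hz wz pz a : R) : 0 < a -> wz <= hz ->
    ~~ (hz - (0 + pz) <= wz - pz - a / 2) by rewrite -ltNge; lra.
move=> w_maj phi_C2 Oz touch; rewrite leNgt; apply/negP => phi_lt_c.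
have [eta eta0 psi_lt_c] := tr_hessian_perturb_lt phi_C2 Oz phi_lt_c.
set psi := _ + phi in psi_lt_c.
have psiE x : psi x = eta * sqdist z x + phi x by [].
have sqdist_C2 : C2_on Omega (sqdist z) := polyfun_C2 (polyfun_sqdist z).
have psi_C2 : C2_on Omega psi := C2_on_linear eta Omega_open sqdist_C2 phi_C2.
have [psi_lt_k k_lt_c] := midf_lt psi_lt_c.
set k := _ / 2 in psi_lt_k k_lt_c.
have [r r0 near_z] : exists2 r, 0 < r & closed_eball z r `<=`
    [set x | [/\ Omega x, tr_hessian A psi x < k & w x - phi x <= w z - phi z]].
  apply: nbhs_closed_eball; near=> x; split; near: x => //.
    exact: near_open Omega_open Oz.
  by move: (tr_hessian_continuous (A := A) psi_C2 Oz) => /cvgr_lt; apply.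
have ballO : closed_eball z r `<=` Omega by move=> x /near_z[].
have etar0 : 0 < eta * r ^+ 2 by rewrite mulr_gt0// exprn_gt0.
have e0 : 0 < eta * r ^+ 2 / 2 by rewrite divr_gt0.
have [h [h_C2 hk w_le_h h_le_w]] := w_maj k z r _ k_lt_c r0 e0 ballO.
have h_sub := tr_hessian_eq_visc_subsol A_symm A_psd Omega_open h_C2 hk.
have zr := closed_eball_center z r.
have : h z - psi z <= w z - phi z - eta * r ^+ 2 / 2.
  apply: (visc_subsol_comparison Omega_open h_sub psi_C2 ballO) zr => x xr.
    rewrite affine_op_hessian subr_lt0.
    by have [] := near_z x (sub_eball_closed_eball xr).
  have [_ _ touch_x] := near_z x (sub_esphere_closed_eball xr).
  by rewrite psiE [sqdist z x]xr; exact: on_sphere (h_le_w x xr) touch_x.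
rewrite psiE sqdistxx mulr0; apply/negP; apply: at_center => //.
exact: w_le_h.
Unshelve. all: end_near. Qed.

Lemma has_harmonic_majorants_convex c u v theta : 0 < theta < 1 ->
  has_harmonic_majorants c u -> has_harmonic_majorants c v ->
  has_harmonic_majorants c (fun x => theta * u x + (1 - theta) * v x).
Proof.
move=> /andP[t0 t1] u_maj v_maj k z r e kc r0 e0 ballO.
have [hu [hu_C2 huk u_le_hu hu_le_u]] := u_maj k z r e kc r0 e0 ballO.
have [hv [hv_C2 hvk v_le_hv hv_le_v]] := v_maj k z r e kc r0 e0 ballO.
pose dh := -1 *: hv + hu; pose h := theta *: dh + hv.
have dh_C2 : C2_on Omega dh := C2_on_linear (-1) Omega_open hv_C2 hu_C2.
have hE x : h x = theta * hu x + (1 - theta) * hv x.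
  by rewrite -[LHS]/(theta * (-1 * hv x + hu x) + hv x); ring.
have conv_le (a b a' b' : R) : a <= a' -> b <= b' ->
    theta * a + (1 - theta) * b <= theta * a' + (1 - theta) * b'.
  by move=> aa bb; rewrite lerD// ler_wpM2l// ?subr_ge0 ltW.
exists h; split=> [|x Ox|x xr|x xr].
- exact: C2_on_linear.
- rewrite (tr_hessian_linear _ _ Omega_open dh_C2 hv_C2 Ox).
  rewrite (tr_hessian_linear _ _ Omega_open hv_C2 hu_C2 Ox) huk// hvk//.
  by rewrite mulN1r addNr mulr0 add0r.
- by rewrite hE conv_le ?u_le_hu ?v_le_hv.
- have := conv_le _ _ _ _ (hu_le_u x xr) (hv_le_v x xr); rewrite hE.
  by move/le_trans; apply; lra.
Qed.

Lemma visc_subsolP c w : {within Omega, continuous w} ->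
  visc_subsol (affine_op A c) Omega w <-> has_harmonic_majorants c w.
Proof.
move=> wc; split=> [|w_maj]; first exact: visc_subsol_harmonic_majorants.
split=> // phi z phi_C2 Oz touch; rewrite subr_ge0.
exact: harmonic_majorants_touch w_maj phi_C2 Oz touch.
Qed.

End LinearEquation.

Lemma within_continuous_convex (T : topologicalType) (R : realType)
    (Omega : set T) (u v : T -> R) (theta : R) :
  {within Omega, continuous u} -> {within Omega, continuous v} ->
  {within Omega, continuous (fun x => theta * u x + (1 - theta) * v x)}.
Proof.
move=> uc vc x.
by apply: cvgD; apply: cvgM; do ?[exact: cvg_cst]; [exact: uc|exact: vc].
Qed.

Lemma affine_visc_subsol_convex (R : realType) (n : nat) (A : 'M[R]_n) (c : R)
    (Omega : set 'rV[R]_n) (u v : 'rV[R]_n -> R) (theta : R) :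
  symmx A -> psd A -> A != 0 -> open Omega ->
  visc_subsol (affine_op A c) Omega u -> visc_subsol (affine_op A c) Omega v ->
  0 < theta < 1 ->
  visc_subsol (affine_op A c) Omega (fun x => theta * u x + (1 - theta) * v x).
Proof.
move=> As Ap A0 Oo u_sub v_sub t01.
have wc := within_continuous_convex (theta := theta) u_sub.1 v_sub.1.
apply/(visc_subsolP As Ap A0 Oo c wc).
apply: has_harmonic_majorants_convex => //.
  exact: visc_subsol_harmonic_majorants u_sub.
exact: visc_subsol_harmonic_majorants v_sub.
Qed.

Theorem theorem4p6 (R : realType) (n : nat) (F : 'M[R]_n -> R) (lam Lam : R)
  (u v : 'rV[R]_n -> R) (theta : R) :
  unif_elliptic F lam Lam ->
  {within [set M : 'M[R]_n | symmx M], continuous F} ->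
  quasiconcave F ->
  visc_subsol F (@B1 R n) u -> visc_subsol F (@B1 R n) v ->
  0 < theta < 1 ->
  visc_subsol F (@B1 R n) (fun x => theta * u x + (1 - theta) * v x).
Proof.
move=> /unif_elliptic_degenerate Fell Fc Fq u_sub v_sub t01.
have B1_open : open (@B1 R n) by rewrite B1_eball; exact: open_eball.
split=> [|phi z phi_C2 Bz touch].
  exact: within_continuous_convex u_sub.1 v_sub.1.
have phi_symm := hessian_symmx B1_open phi_C2 Bz.
rewrite leNgt; apply/negP => Fphi.
have F_nonneg := visc_subsol_superlevel_neq0 B1_open u_sub Bz.
have [A [c [As Ap A0 F_affine]]] :=
  superlevel_separation Fc Fq Fell F_nonneg phi_symm Fphi.
rewrite ltNge => /negP; apply.
have [_] := affine_visc_subsol_convex As Ap A0 B1_open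
  (visc_subsol_mono B1_open F_affine u_sub)
  (visc_subsol_mono B1_open F_affine v_sub) t01.
exact.
Qed.
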